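(* Let $T:\mathbb{T}\to\mathbb{T}$ be an ergodic rotation, i.e. $Tx=x+\alpha$ with $\alpha$ irrational. Suppose that $f:\mathbb{T}\to\mathbb{R}$ is a positive and bounded away from zero piecewise absolutely continuous function with $S(f)\neq 0$. Then the special flow $T^f$ is not partially rigid (that is, it is not partially rigid along any sequence $(t_n)$ with $t_n\to+\infty$).
   Context: $\mathbb{T}=\mathbb{R}/\mathbb{Z}$ is identified with $[0,1)$ and carries Lebesgue measure $\mu$. A function $f:\mathbb{T}\to\mathbb{R}$ is piecewise absolutely continuous if there are $\beta_1,\dots,\beta_k\in\mathbb{T}$ (in cyclic order, $\beta_{k+1}=\beta_1$) such that $f|_{(\beta_j,\beta_{j+1})}$ is absolutely continuous for each $j$. With $f_\pm(\beta)=\lim_{y\to\beta^\pm}f(y)$, the sum of jumps is $S(f)=\sum_{j=1}^k\big(f_-(\beta_j)-f_+(\beta_j)\big)=\int_{\mathbb{T}}f'(x)\,dx$. For $m\in\mathbb{Z}$, $f^{(m)}(x)=\sum_{i=0}^{m-1}f(T^ix)$ if $m>0$, $f^{(0)}=0$, and $f^{(m)}(x)=-\sum_{i=m}^{-1}f(T^ix)$ if $m<0$. The special flow $T^f=(T^f_t)_{t\in\mathbb{R}}$ acts on $\mathbb{T}^f=\{(x,s)\in\mathbb{T}\times\mathbb{R}:0\le s<f(x)\}$ with the finite measure $\mu^f$ which is the restriction of $\mu\otimes\lambda$ ($\lambda$ = Lebesgue measure on $\mathbb{R}$), by $T^f_t(x,s)=(T^nx,s+t-f^{(n)}(x))$ where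 $n\in\mathbb{Z}$ is the unique integer with $f^{(n)}(x)\le s+t<f^{(n+1)}(x)$. A measure-preserving flow $(S_t)$ on a finite measure space $(X,\mathcal{B},\mu)$ is partially rigid along $(t_n)$, $t_n\to+\infty$, if there is $0<u\le1$ such that $\liminf_{n\to\infty}\mu(A\cap S_{-t_n}A)\ge u\,\mu(A)$ for every $A\in\mathcal{B}$. *)

(* Defs.v *)
From HB Require Import structures.
From mathcomp Require Import all_boot all_order all_algebra.
From mathcomp Require Import all_classical all_reals all_analysis.

Set Implicit Arguments.
Unset Strict Implicit.
Unset Printing Implicit Defensive.

Import Order.TTheory GRing.Theory Num.Theory.
Import numFieldNormedType.Exports.

Local Open Scope classical_set_scope.
Local Open Scope ring_scope.

(* Points of the circle R/Z are represented by [0, 1[, and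
   a function on R/Z by a 1-periodic function R -> R, so that every arc of the
   circle lifts to an interval of R. *)

Definition circle_function (R : realType) (f : R -> R) : Prop :=
  forall x, f (x + 1) = f x.

Definition abs_continuous (R : realType) (I : interval R) (f : R -> R) : Prop :=
  forall e : R, 0 < e -> exists2 d : R, 0 < d &
    forall (n : nat) (u v : 'I_n -> R),
      (forall i, [/\ u i \in I, v i \in I & u i <= v i]) ->
      trivIset setT (fun i => [set` `]u i, v i[]) ->
      \sum_(i < n) (v i - u i) < d ->
      \sum_(i < n) `|f (v i) - f (u i)| < e.

(* The k >= 1 break points, in cyclic order, are lifted to
   beta 0 < ... < beta (k - 1) < beta k = beta 0 + 1; the arc that closes the
   circle is ]beta (k - 1), beta 0 + 1[ (the circle minus a point if k = 1). *)
Definition pw_abs_continuous (R : realType) (f : R -> R)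
    (k : nat) (beta : nat -> R) : Prop :=
  [/\ (0 < k)%N,
      beta k = beta 0%N + 1,
      forall j, (j < k)%N -> beta j < beta j.+1 &
      forall j, (j < k)%N -> abs_continuous `]beta j, beta j.+1[ f].

Definition sum_of_jumps (R : realType) (f : R -> R)
    (k : nat) (beta : nat -> R) : R :=
  \sum_(j < k) (lim (f y @[y --> (beta j)^'-]) - lim (f y @[y --> (beta j)^'+])).

Definition rotation (R : realType) (alpha x : R) : R :=
  (x + alpha) - (Num.floor (x + alpha))%:~R.

(* m-th iterate, m : int; the inverse of the rotation by alpha is the rotation
   by - alpha, and Negz n = - (n + 1). *)
Definition rotation_iter (R : realType) (alpha : R) (m : int) (x : R) : R :=
  match m with
  | Posz n => iter n (rotation alpha) x
  | Negz n => iter n.+1 (rotation (- alpha)) x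
  end.

Definition birkhoff_sum (R : realType) (alpha : R) (f : R -> R)
    (m : int) (x : R) : R :=
  match m with
  | Posz n => \sum_(i < n) f (rotation_iter alpha (Posz i) x)
  | Negz n => - \sum_(i < n.+1) f (rotation_iter alpha (Negz i) x)
  end.

Definition plane (R : realType) := (measurableTypeR R * measurableTypeR R)%type.

Definition special_space (R : realType) (f : R -> R) : set (plane R) :=
  [set p : R * R | 0 <= p.1 < 1 /\ 0 <= p.2 < f p.1].

(* Restriction of the product measure (for the Borel sigma-algebra). *)
Definition special_measure (R : realType) (f : R -> R)
    (A : set (plane R)) : \bar R :=
  (((@lebesgue_measure R) \x (@lebesgue_measure R)) (A `&` special_space f))%E.

(* The integer n is unique, and it exists as soon as f is bounded away from 0;
   the default value 0 of xget is then irrelevant. *)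
Definition special_step (R : realType) (alpha : R) (f : R -> R) (x r : R) : int :=
  xget 0 [set n : int |
    birkhoff_sum alpha f n x <= r < birkhoff_sum alpha f (n + 1) x].

Definition special_flow (R : realType) (alpha : R) (f : R -> R)
    (t : R) (p : plane R) : plane R :=
  let: (x, s) := p : R * R in
  let n := special_step alpha f x (s + t) in
  (rotation_iter alpha n x, s + t - birkhoff_sum alpha f n x).

(* Partial rigidity along t of a flow S on the measurable subset X of T,
   equipped with the measurable sets contained in X and with mu. *)
Definition partially_rigid_along (R : realType) (d : measure_display)
    (T : measurableType d) (X : set T) (mu : set T -> \bar R)
    (S : R -> T -> T) (t : nat -> R) : Prop :=
  exists u : R, 0 < u <= 1 /\
    forall A : set T, measurable A -> A `<=` X ->
      (u%:E * mu A <= limn_einf (fun n => mu (A `&` (S (- t n)%R @` A))))%E.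

Definition partially_rigid (R : realType) (d : measure_display)
    (T : measurableType d) (X : set T) (mu : set T -> \bar R)
    (S : R -> T -> T) : Prop :=
  exists t : nat -> R,
    (t n @[n --> \oo] --> +oo) /\ partially_rigid_along X mu S t.

(* Main.v *)
Require Import Defs.
From mathcomp Require Import all_boot all_order all_algebra.
From mathcomp Require Import all_classical all_reals all_analysis.
From mathcomp Require Import zify ring lra.
Set Implicit Arguments.
Unset Strict Implicit.
Unset Printing Implicit Defensive.
Import Order.TTheory GRing.Theory Num.Theory.
Import numFieldNormedType.Exports.
Local Open Scope classical_set_scope.
Local Open Scope ring_scope.

(** The rigidity inequality is tested on the low box [0,1[ x [0,eps[.  If (x, s)
    lies in the box and is the image under S_{-t} of a point of the box, then
    some Birkhoff sum satisfies |f^(j)(x) - t| < eps ([low_box_returns]).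
    Writing E_t(eps) for the set of such x, partial rigidity with constant u
    would keep the measure of E_{t_n}(eps) above u / 2, say, for every eps and all
    large n.  But E_t(eps) has measure at most C eps once t is large, with C independent of
    eps ([sparse_returns]): a contradiction as soon as C eps < u.

    The bound on E_t(eps) comes from the jumps.  Since f is bounded and bounded
    away from 0, only the j comparable to t matter; they are at most some J
    comparable to t.  The sums f^(j), j <= J, have O(J) discontinuities
    altogether, and between two consecutive ones f^(j) has slope about j S(f),
    because the orbit averages of f' tend to S(f) <> 0.  Cut the arcs further so
    that their lengths are at most 1/J.  On one arc each set
    |f^(j) - t| < eps then has diameter O(eps / J), and boundedly many j
    contribute, because f^(j) oscillates by O(1) there while f^(j+1) - f^(j) is
    at least inf f.  Summing over O(J) arcs gives O(eps).

    As f' is merely integrable, its orbit averages need not converge uniformly.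
    This is repaired by splitting off a part of small variation
    ([circle_approximation]): there are a step function sg, with integral close
    to S(f), and a nondecreasing function Lam that grows by at most delta on
    each period, such that
      |f v - f u - sg u (v - u)| <= Lam v - Lam u
    for close points u <= v of a common arc of continuity.  The averages of sg
    converge uniformly, by equidistribution of the rotation
    ([arc_indicator_equidistributed]).  The errors made by f^(j), for all
    j <= J at once, are increments of the single nondecreasing function
    sum_(i < J) Lam (x + i alpha), whose growth over a period is at most
    J delta; with delta <= eps, O(J) further cuts make it at most eps on every
    arc.  All the cuts are encoded by one nondecreasing integer-valued
    function, [level], whose level sets are the arcs ([level_increment]).

    The pair sg, Lam is found without differentiating f ([ac_cell_slopes]).
    Take a partition that almost exhausts the total variation of f - s x
    simultaneously for all slopes s in a fine finite grid.  On each cell, the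
    variation of f - s x hardly exceeds the modulus of its increment, and that
    increment is small when s is a grid point next to the slope of the chord.
    The cells whose chord is too steep for the grid have small total length, so
    absolute continuity makes the variation of f itself small on them, and s = 0
    will do. *)

(** * Dirichlet approximation and sums of integer parts *)

Section floor_sums.
Variable R : realType.
Implicit Types x a b alpha : R.

Lemma floor_bounds x : ((Num.floor x)%:~R <= x) /\ (x < (Num.floor x)%:~R + 1).
Proof. by have /andP[? ?] := floor_itv x; rewrite -intrD1. Qed.

Lemma floor_addint x (z : int) : Num.floor (x + z%:~R) = Num.floor x + z.
Proof. by rewrite floorDrz ?intr_int// intrKfloor. Qed.

Lemma sum_leq_ord (m q : nat) : (m <= q)%N -> (\sum_(k < q) (m <= k)%N = q - m)%N.
Proof.
elim: q => [|q IH]; first by rewrite big_ord0.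
rewrite leq_eqVlt => /orP[/eqP ->|]; last first.
  by rewrite ltnS => mq; rewrite big_ord_recr/= IH// mq; lia.
by rewrite subnn big1// => i _; rewrite leqNgt ltn_ord.
Qed.

(** Hermite's identity.  With n the integer part of q x, the k-th term is the
    Euclidean quotient of n + k by q, which is that of n by q, plus 1 exactly when
    k >= q - n mod q. *)
Lemma sum_floor_equispaced (q : nat) x : (0 < q)%N ->
  \sum_(k < q) Num.floor (x + k%:R / q%:R) = Num.floor (q%:R * x).
Proof.
move=> q0; set n := Num.floor (q%:R * x).
have [nl nu] := floor_bounds (q%:R * x); rewrite -/n in nl nu.
pose a := (n %/ q)%Z; pose r := `|(n %% q)%Z|%N.
have qz : (q%:Z != 0) by lia.
have rE : (r%:Z = n %% q)%Z by rewrite /r gez0_abs// modz_ge0.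
have q0z : 0 < q%:Z by [].
have rq : (r < q)%N.
  by have := ltz_pmod n q0z; rewrite -rE; lia.
have nE : n = a * q%:Z + r%:Z by rewrite rE; exact: divz_eq.
have nR : n%:~R = a%:~R * q%:R + r%:R :> R by rewrite nE rmorphD rmorphM.
have q0R : 0 < q%:R :> R by rewrite ltr0n.
have fE (k : 'I_q) :
    Num.floor (x + k%:R / q%:R) = a + (q - r <= k)%N%:Z.
  apply: floor_def; have -> : x + k%:R / q%:R = (q%:R * x + k%:R) / q%:R.
    by field; rewrite gt_eqF.
  have kq := ltn_ord k.
  rewrite ler_pdivlMr// ltr_pdivrMr// !rmorphD/=.
  case: leqP => h /=.
    have h1 : q%:R <= r%:R + k%:R :> R by rewrite -natrD ler_nat; lia.
    have h2 : r%:R + k%:R + 1 <= q%:R + q%:R :> R.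
      by rewrite -[1]/(1%:R) -!natrD ler_nat; lia.
    by apply/andP; split; nra.
  have h2 : r%:R + k%:R + 1 <= q%:R :> R.
    by rewrite -[1]/(1%:R) -!natrD ler_nat; lia.
  have h3 : 0 <= r%:R :> R by [].
  have h4 : 0 <= k%:R :> R by [].
  by apply/andP; split; nra.
rewrite (eq_bigr _ (fun k _ => fE k)) big_split/= sumr_const card_ord.
rewrite -(big_morph Posz PoszD (erefl (Posz 0))) sum_leq_ord ?leq_subr//.
by rewrite nE; lia.
Qed.

(** For p prime to q, the points i p / q run through all k / q modulo 1, so this
    reduces to Hermite's identity; the integer parts of the i p / q are collected
    in C.  It is essential that C does not depend on x: it cancels in differences
    such as [arc_indicator]. *)
Lemma sum_floor_rational (p : int) (q : nat) : (0 < q)%N -> coprime `|p| q ->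
  exists C : int, forall x,
    \sum_(i < q) Num.floor (x + i%:R * (p%:~R / q%:R)) = Num.floor (q%:R * x) + C.
Proof.
move=> q0 cpq; exists (\sum_(i < q) ((i%:Z * p) %/ q)%Z) => x.
have q0R : 0 < q%:R :> R by rewrite ltr0n.
have qz : (q%:Z != 0) by lia.
have hq (i : 'I_q) : (`|((i%:Z * p) %% q)%Z|%N < q)%N.
  have q0z : 0 < q%:Z by [].
  have := ltz_pmod (i%:Z * p) q0z; have := modz_ge0 (i%:Z * p) qz.
  by case: (_ %% _)%Z.
pose h (i : 'I_q) : 'I_q := Ordinal (hq i).
have h_inj : injective h.
  move=> i j /(congr1 val)/= /(congr1 Posz).
  rewrite !gez0_abs ?modz_ge0// => /eqP.
  rewrite eqz_mod_dvd -mulrBl mulrC Gauss_dvdzr; last first.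
    by rewrite coprimezE coprime_sym.
  move=> /dvdzP[c ijE]; apply/val_inj => /=.
  have iq := ltn_ord i; have jq := ltn_ord j; move: ijE iq jq.
  by case: (ltrgtP c 0) => [c0|c0|->]; [nia|nia|lia].
rewrite -(sum_floor_equispaced x q0) [in RHS](reindex_inj h_inj)/= -big_split/=.
apply: eq_bigr => i _; rewrite -floor_addint; congr Num.floor.
rewrite natr_absz (ger0_norm (modz_ge0 _ _))// -addrA; congr (_ + _).
move: (divz_eq (i%:Z * p) q%:Z); move: (_ %/ _)%Z (_ %% _)%Z => d m.
move=> /(congr1 (fun z : int => z%:~R : R)); rewrite rmorphD !rmorphM/= => iE.
by rewrite mulrA [i%:R * _]iE; field; rewrite gt_eqF.
Qed.

Lemma dirichlet_pigeonhole alpha (N : nat) : (0 < N)%N ->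
  exists q : nat, exists p : int,
    [/\ (0 < q)%N, (q <= N)%N & `|q%:R * alpha - p%:~R| * N%:R < 1].
Proof.
move=> N0; have N0R : 0 < N%:R :> R by rewrite ltr0n.
pose fr (i : nat) : R := i%:R * alpha - (Num.floor (i%:R * alpha))%:~R.
have fr0 i : 0 <= fr i by rewrite subr_ge0; have [] := floor_bounds (i%:R * alpha).
have fr1 i : fr i < 1 by rewrite /fr; have [_ ?] := floor_bounds (i%:R * alpha); lra.
have bN (i : nat) : (Num.truncn (N%:R * fr i) < N)%N.
  by rewrite truncn_lt_nat ?mulr_ge0// -[ltRHS]mulr1 ltr_pM2l.
pose b (i : 'I_N.+1) : 'I_N := Ordinal (bN i).
have : ~ injective b by move=> /leq_card; rewrite !card_ord ltnn.
move=> /injectiveP/injectivePn[i [j ij]] /(congr1 val)/= bij.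
wlog lt_ij : i j ij bij / (i < j)%N.
  move=> H; have [lt|lt|/val_inj e] := ltngtP i j; first exact: (H i j).
    by apply: (H j i) => //; rewrite eq_sym.
  by rewrite e eqxx in ij.
exists (j - i)%N, (Num.floor (j%:R * alpha) - Num.floor (i%:R * alpha)).
have := ltn_ord j; rewrite ltnS => jN; split; [by rewrite subn_gt0|lia|].
have -> : (j - i)%:R * alpha - (Num.floor (j%:R * alpha) -
   Num.floor (i%:R * alpha))%:~R = fr j - fr i.
  by rewrite natrB 1?ltnW// rmorphB /fr/=; ring.
have /andP[i1 i2] := truncn_itv (mulr_ge0 (ltW N0R) (fr0 i)).
have /andP[j1 j2] := truncn_itv (mulr_ge0 (ltW N0R) (fr0 j)).
rewrite -(gtr0_norm N0R) -normrM ltr_norml; rewrite bij in i1 i2.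
move: i2 j2; rewrite -natr1 => i2 j2; apply/andP; split; lra.
Qed.

Lemma irrational_dist alpha (Q : nat) : irrational alpha ->
  exists2 eta : R, 0 < eta & forall (q : nat) (p : int), (0 < q)%N -> (q <= Q)%N ->
    eta <= `|q%:R * alpha - p%:~R|.
Proof.
move=> irr; elim: Q => [|Q [eta eta0 IH]]; first by exists 1 => // q p; lia.
set y := Q.+1%:R * alpha; have [yl yu] := floor_bounds y.
have ny (z : int) : y != z%:~R.
  apply/eqP => yz; apply: irr; apply/rationalP; exists z, Q.+1.
  by rewrite -yz /y; field.
pose m := Num.min (y - (Num.floor y)%:~R) ((Num.floor y)%:~R + 1 - y).
have m0 : 0 < m.
  rewrite lt_min subr_gt0 lt_neqAle eq_sym ny yl/= subr_gt0 lt_neqAle.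
  by rewrite ltW// andbT -intrD1 ny.
exists (Num.min eta m); first by rewrite lt_min eta0.
move=> q p q0; rewrite leq_eqVlt => /orP[/eqP ->|]; last first.
  by rewrite ltnS => qQ; rewrite ge_min IH.
rewrite ge_min; apply/orP; right; rewrite -/y ge_min.
have [pf|] := leP p (Num.floor y).
  have : p%:~R <= (Num.floor y)%:~R :> R by rewrite ler_int.
  by move=> ?; apply/orP; left; rewrite ger0_norm; lra.
rewrite -lezD1 -(ler_int R) intrD1 => fp.
by apply/orP; right; rewrite ler0_norm; lra.
Qed.

(** Reducing the fraction given by the pigeonhole principle keeps the quality of
    the approximation.  The denominator is large because an irrational number
    stays at a positive distance from all fractions with small denominator. *)
Lemma dirichlet_coprime alpha (Q : nat) : irrational alpha ->
  exists q : nat, exists p : int,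
    [/\ (Q < q)%N, coprime `|p| q & `|q%:R * alpha - p%:~R| * q%:R <= 1].
Proof.
move=> irr; have [eta eta0 etaP] := irrational_dist Q irr.
pose N := (Num.truncn eta^-1).+1.
have NP : 1 < eta * N%:R.
  by rewrite -ltr_pdivrMl// mulr1 truncnS_gt.
have [q [p [q0 qN qp]]] := dirichlet_pigeonhole alpha (ltn0Sn _ : (0 < N)%N).
pose g := gcdn `|p| q; have g0 : (0 < g)%N by rewrite gcdn_gt0 q0 orbT.
pose q' := (q %/ g)%N; pose p' := (p %/ g)%Z.
have qE : (q = q' * g)%N by rewrite divnK// dvdn_gcdr.
have pE : p = p' * g%:Z by rewrite divzK// dvdzE; exact: dvdn_gcdl.
have q'0 : (0 < q')%N by move: q0; rewrite qE muln_gt0 => /andP[].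
have gR : 1 <= g%:R :> R by rewrite ler1n.
have lt1 : `|q'%:R * alpha - p'%:~R| * N%:R < 1.
  apply: le_lt_trans qp; rewrite ler_pM2r ?ltr0n//.
  have -> : q%:R * alpha - p%:~R = g%:R * (q'%:R * alpha - p'%:~R).
    by rewrite qE pE natrM rmorphM/=; ring.
  by rewrite normrM ger0_norm ?ler0n// ler_peMl.
exists q', p'; split.
- rewrite ltnNge; apply/negP => q'Q; have := etaP q' p' q'0 q'Q.
  move=> h; have : 1 < 1 :> R by apply: lt_trans NP (le_lt_trans _ lt1); rewrite ler_pM2r ?ltr0n.
  by rewrite ltxx.
- rewrite /coprime; apply/eqP; have : g = (gcdn `|p'| q' * g)%N.
    by rewrite muln_gcdl -qE -[X in (_ * X)%N]absz_nat -abszM -pE.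
  by move/eqP; rewrite -{1}[g]mul1n eqn_pmul2r// eq_sym => /eqP.
- apply: (le_trans _ (ltW lt1)); rewrite ler_wpM2l// ler_nat.
  by apply: leq_trans qN; rewrite qE leq_pmulr.
Qed.

End floor_sums.

(** * Uniform distribution of orbits in arcs *)

Section equidistribution.
Variables (R : realType) (alpha : R).
Implicit Types (x a b : R) (s : R -> R).

(** Indicator function of the lift to the line of the arc [a, b[, if
    a <= b <= a + 1.  Written with integer parts, it is periodic on the nose and
    its orbit sums are governed by Hermite's identity. *)
Definition arc_indicator a b x : R := (Num.floor (x - a) - Num.floor (x - b))%:~R.

Definition uniformly_averages_to s (c : R) := forall d, 0 < d ->
  exists n0 : nat, forall n x, (n0 <= n)%N ->
    `|\sum_(i < n) s (x + i%:R * alpha) - n%:R * c| <= n%:R * d.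

Lemma uniformly_averages_to0 : uniformly_averages_to (fun=> 0) 0.
Proof.
move=> d d0; exists 0%N => n x _; rewrite big1// mulr0 subr0 normr0.
by rewrite mulr_ge0// ltW.
Qed.

Lemma uniformly_averages_toD s1 s2 c1 c2 :
  uniformly_averages_to s1 c1 -> uniformly_averages_to s2 c2 ->
  uniformly_averages_to (fun x => s1 x + s2 x) (c1 + c2).
Proof.
move=> h1 h2 d d0; have d2 : 0 < d / 2 by rewrite divr_gt0.
have [n1 n1P] := h1 _ d2; have [n2 n2P] := h2 _ d2.
exists (maxn n1 n2) => n x; rewrite geq_max => /andP[l1 l2].
have e1 := n1P _ x l1; have e2 := n2P _ x l2.
rewrite big_split/= mulrDr opprD addrACA (le_trans (ler_normD _ _))//.
by rewrite (splitr d) mulrDr lerD.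
Qed.

Lemma uniformly_averages_toZ k s c : uniformly_averages_to s c ->
  uniformly_averages_to (fun x => k * s x) (k * c).
Proof.
move=> h d d0; have dk : 0 < d / (`|k| + 1) by rewrite divr_gt0// ltr_wpDl.
have [n0 n0P] := h _ dk; exists n0 => n x l; have e := n0P _ x l.
rewrite -mulr_sumr mulrCA -mulrBr normrM.
apply: (@le_trans _ _ ((`|k| + 1) * (n%:R * (d / (`|k| + 1))))).
  by apply: ler_pM => //; rewrite lerDl.
by rewrite mulrCA [X in _ * X]mulrC divfK ?gt_eqF ?ltr_wpDl.
Qed.

Lemma uniformly_averages_to_sum (n : nat) (s : nat -> R -> R) (c : nat -> R) :
  (forall i, (i < n)%N -> uniformly_averages_to (s i) (c i)) ->
  uniformly_averages_to (fun x => \sum_(i < n) s i x) (\sum_(i < n) c i).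
Proof.
elim: n => [_|n IH h].
  rewrite (_ : (fun=> _) = fun=> 0) ?big_ord0; first exact: uniformly_averages_to0.
  by apply/funext => x; rewrite big_ord0.
rewrite (_ : (fun=> _) = fun x => \sum_(i < n) s i x + s n x); last first.
  by apply/funext => x; rewrite big_ord_recr.
rewrite big_ord_recr/=; apply: uniformly_averages_toD; last exact: h.
by apply: IH => i /ltnW; exact: h.
Qed.

(** An orbit segment of length m q + r splits into m blocks of length q, each with
    error at most E whatever its starting point, and r leftover terms with error
    at most 1. *)
Lemma block_averages s c (q : nat) (E : R) :
  (forall x, `|s x - c| <= 1) -> 0 <= E ->
  (forall x, `|\sum_(i < q) s (x + i%:R * alpha) - q%:R * c| <= E) ->
  forall m r x, `|\sum_(i < m * q + r) s (x + i%:R * alpha) - (m * q + r)%:R * c|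
    <= m%:R * E + r%:R.
Proof.
move=> s1 E0 blk; elim=> [|m IH] r x.
  rewrite mul0n add0n mul0r add0r; elim: r => [|r IH].
    by rewrite big_ord0 mul0r subrr normr0.
  rewrite big_ord_recr/= -!natr1 mulrDl mul1r opprD addrACA.
  by rewrite (le_trans (ler_normD _ _))// lerD.
rewrite mulSn -addnA big_split_ord/= natrD mulrDl opprD addrACA.
rewrite (le_trans (ler_normD _ _))// -natr1 mulrDl mul1r -addrA addrCA lerD//.
under eq_bigr do rewrite natrD mulrDl addrA.
exact: IH.
Qed.

Lemma arc_indicator_dist a b x : `|arc_indicator a b x - (b - a)| <= 1.
Proof.
rewrite /arc_indicator rmorphB/=.
have [? ?] := floor_bounds (x - a); have [? ?] := floor_bounds (x - b).
by rewrite ler_norml; apply/andP; split; lra.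
Qed.

(** For i < q the points i alpha and i p / q differ by at most 1 / q, and a shift
    of x by 1 / q changes the integer part of q x by 1.  Hence the count of visits
    to the arc differs from q (b - a) by at most 1 for each end point, plus 1 for
    the rounding. *)
Lemma arc_indicator_block a b (q : nat) (p : int) : (0 < q)%N ->
  coprime `|p| q -> `|q%:R * alpha - p%:~R| * q%:R <= 1 ->
  forall x, `|\sum_(i < q) arc_indicator a b (x + i%:R * alpha) - q%:R * (b - a)|
    <= 3.
Proof.
move=> q0 cpq qp x; have [C CP] := sum_floor_rational R q0 cpq.
have q0R : 0 < q%:R :> R by rewrite ltr0n.
have qV : q%:R * q%:R^-1 = 1 :> R by rewrite divff// gt_eqF.
have near (i : 'I_q) : `|i%:R * alpha - i%:R * (p%:~R / q%:R)| <= q%:R^-1.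
  have -> : i%:R * alpha - i%:R * (p%:~R / q%:R)
     = i%:R * (q%:R * alpha - p%:~R) / q%:R by field; rewrite gt_eqF.
  rewrite !normrM (ger0_norm (ler0n _ _)) normfV (ger0_norm (ler0n _ _)).
  rewrite ler_piMl ?invr_ge0 ?ler0n//.
  by rewrite mulrC (le_trans _ qp)// ler_wpM2l// ler_nat ltnW.
have up y : \sum_(i < q) Num.floor (y + i%:R * alpha) <= Num.floor (q%:R * y) + 1 + C.
  have <- : Num.floor (q%:R * (y + q%:R^-1)) = Num.floor (q%:R * y) + 1.
    by rewrite mulrDr qV -(floor_addint _ 1).
  rewrite -CP.
  apply: ler_sum => i _; apply: le_floor.
  by have := near i; rewrite ler_norml => /andP[_]; lra.
have lo y : Num.floor (q%:R * y) - 1 + C <= \sum_(i < q) Num.floor (y + i%:R * alpha).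
  have <- : Num.floor (q%:R * (y - q%:R^-1)) = Num.floor (q%:R * y) - 1.
    by rewrite mulrBr qV -(floor_addint _ (- 1)) rmorphN.
  rewrite -CP.
  apply: ler_sum => i _; apply: le_floor.
  by have := near i; rewrite ler_norml => /andP[+ _]; lra.
rewrite /arc_indicator -rmorph_sum/=.
rewrite sumrB.
have sh c : \sum_(i < q) Num.floor (x + i%:R * alpha - c)
    = \sum_(i < q) Num.floor (x - c + i%:R * alpha).
  by apply: eq_bigr => i _; rewrite addrAC.
rewrite !sh.
move: (up (x - a)) (lo (x - a)) (up (x - b)) (lo (x - b)).
set A := \sum_(i < q) _; set B := \sum_(i < q) _.
rewrite -!(ler_int R) !rmorphD !rmorphN/=.
have [? ?] := floor_bounds (q%:R * (x - a)).
have [? ?] := floor_bounds (q%:R * (x - b)).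
by move=> *; rewrite ler_norml; apply/andP; split; lra.
Qed.

Theorem arc_indicator_equidistributed a b : irrational alpha ->
  uniformly_averages_to (arc_indicator a b) (b - a).
Proof.
move=> irr d d0; pose Q := Num.truncn (6 / d).
have [q [p [Qq cpq qp]]] := dirichlet_coprime Q irr.
have q0 : (0 < q)%N by apply: leq_ltn_trans Qq.
have q0R : 0 < q%:R :> R by rewrite ltr0n.
have dq : 6 <= d * q%:R.
  rewrite -ler_pdivrMl// mulrC; apply: ltW; apply: lt_le_trans (truncnS_gt _) _.
  by rewrite ler_nat.
exists (Num.truncn (2 * q%:R / d)).+1 => n x nn.
have nR : 2 * q%:R <= n%:R * d.
  rewrite -ler_pdivrMr//; apply: ltW; apply: lt_le_trans (truncnS_gt _) _.
  by rewrite ler_nat.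
have := block_averages (arc_indicator_dist a b) (ler0n R 3)
  (arc_indicator_block a b q0 cpq qp) (n %/ q) (n %% q) x.
rewrite -divn_eq => /le_trans; apply.
have r1 : (n %% q)%:R <= q%:R :> R by rewrite ler_nat ltnW// ltn_pmod.
have m1 : (n %/ q)%:R * q%:R <= n%:R :> R by rewrite -natrM ler_nat leq_trunc_div.
have : (n %/ q)%:R * 6 <= n%:R * d.
  apply: (@le_trans _ _ ((n %/ q)%:R * (d * q%:R))); first by rewrite ler_wpM2l.
  by rewrite mulrCA mulrC ler_wpM2r// ltW.
lra.
Qed.

Lemma arc_indicator_periodic a b x (z : int) :
  arc_indicator a b (x + z%:~R) = arc_indicator a b x.
Proof.
by rewrite /arc_indicator -!(addrAC _ _ z%:~R) !floor_addint opprD addrACA subrr addr0.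
Qed.

Lemma floor_unit x (z : int) : z%:~R <= x -> x < z%:~R + 1 -> Num.floor x = z.
Proof. by move=> zx xz; apply: floor_def; rewrite zx intrD1. Qed.

Lemma arc_indicator_in a b x : a <= x < b -> b <= a + 1 -> arc_indicator a b x = 1.
Proof.
move=> /andP[ax xb] ab; rewrite /arc_indicator.
have -> : Num.floor (x - a) = 0 by apply: floor_unit; lra.
by have -> : Num.floor (x - b) = -1 by apply: floor_unit; rewrite (_ : (-1)%:~R = -1 :> R) //; lra.
Qed.

Lemma arc_indicator_left a b x : x < a -> a <= b <= x + 1 -> arc_indicator a b x = 0.
Proof.
move=> xa /andP[ab bx]; rewrite /arc_indicator.
have -> : Num.floor (x - a) = -1 by apply: floor_unit; rewrite (_ : (-1)%:~R = -1 :> R) //; lra.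
by have -> : Num.floor (x - b) = -1 by apply: floor_unit; rewrite (_ : (-1)%:~R = -1 :> R) //; lra.
Qed.

Lemma arc_indicator_right a b x : b <= x -> a <= b -> x < a + 1 -> arc_indicator a b x = 0.
Proof.
move=> bx ab xa; rewrite /arc_indicator.
have -> : Num.floor (x - a) = 0 by apply: floor_unit; lra.
by have -> : Num.floor (x - b) = 0 by apply: floor_unit; lra.
Qed.

End equidistribution.

(** * Absolutely continuous functions on an open arc *)

Lemma clamp_le (R : realType) (A B x y : R) : x <= y ->
  Num.max A (Num.min B x) <= Num.max A (Num.min B y).
Proof.
move=> xy; case: (leP B x) => ?; case: (leP B y) => ?;
  case: (leP A B) => ?; case: (leP A x) => ?; case: (leP A y) => ?; lra.
Qed.

Lemma clamp_sub (R : realType) (A B x y : R) : x <= y ->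
  Num.max A (Num.min B y) - Num.max A (Num.min B x) <= y - x.
Proof.
move=> xy; case: (leP B x) => ?; case: (leP B y) => ?;
  case: (leP A B) => ?; case: (leP A x) => ?; case: (leP A y) => ?; lra.
Qed.

Lemma nodes_mono (R : realType) (p : nat -> R) n i j :
  (forall i, (i < n)%N -> p i <= p i.+1) ->
  (i <= j)%N -> (j <= n)%N -> p i <= p j.
Proof.
move=> pS; elim: j => [|j IH]; first by rewrite leqn0 => /eqP ->.
rewrite leq_eqVlt => /orP[/eqP -> //|]; rewrite ltnS => ij jn.
by rewrite (le_trans (IH ij (ltnW jn))) ?pS.
Qed.

Lemma nodes_le (R : realType) (p : nat -> R) n i j :
  (forall i, (i < n)%N -> p i < p i.+1) ->
  (i <= j)%N -> (j <= n)%N -> p i <= p j.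
Proof. by move=> pS; apply: nodes_mono => m /pS/ltW. Qed.

Lemma gt0_lower_bound (R : realType) (x y : R) : 0 < x -> 0 < y ->
  exists m : R, [/\ 0 < m, m <= x & m <= y].
Proof. by move=> x0 y0; exists (Num.min x y); rewrite lt_min x0 y0 !ge_min !lexx orbT. Qed.

Section absolutely_continuous_arc.
Variables (R : realType) (a b : R) (f : R -> R).
Hypotheses (ab : a < b) (acf : abs_continuous `]a, b[ f).

Implicit Types (d e h k m x y u v : R) (p : nat -> R).

Let ba0 : 0 < b - a. Proof. by rewrite subr_gt0. Qed.

Lemma ac_uniform e : 0 < e -> exists2 d : R, 0 < d &
  forall u v, a < u -> u <= v -> v < b -> v - u < d -> `|f v - f u| < e.
Proof.
move=> e0; have [d d0 dP] := acf e0; exists d => // u v au uv vb vud.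
have := dP 1%N (fun=> u) (fun=> v); rewrite !big_ord1; apply => //.
  move=> _; split => //; rewrite in_itv/=; first by rewrite au (le_lt_trans uv).
  by rewrite vb (lt_le_trans au).
by move=> i j _ _ _; rewrite !ord1.
Qed.

Lemma ac_uniform_abs e : 0 < e -> exists2 d : R, 0 < d &
  forall u v, a < u < b -> a < v < b -> `|v - u| < d -> `|f v - f u| < e.
Proof.
move=> e0; have [d d0 dP] := ac_uniform e0.
exists d => // u v /andP[au ub] /andP[av vb] uv.
have [le_uv|/ltW le_vu] := leP u v.
  by apply: dP => //; apply: le_lt_trans uv; exact: ler_norm.
by rewrite distrC; apply: dP => //; apply: le_lt_trans uv; rewrite distrC ler_norm.
Qed.

Lemma ac_cvg_left : cvg (f y @[y --> a^'+]).
Proof.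
apply: cauchy_cvg; apply: cauchy_exP => e e0.
have [d d0 dP] := ac_uniform_abs e0.
have [m [m0 md mb]] := gt0_lower_bound d0 ba0.
exists (f (a + m / 2)).
suff : \forall y \near a^'+, `|f (a + m / 2) - f y| < e by [].
near=> y; apply: dP.
- have : y > a by [].
  have : y < a + m / 2 by near: y; apply: nbhs_right_lt; lra.
  by move=> *; apply/andP; split; lra.
- by apply/andP; split; lra.
- have : y > a by [].
  have : y < a + m / 2 by near: y; apply: nbhs_right_lt; lra.
  by move=> *; rewrite ltr_norml; apply/andP; split; lra.
Unshelve. all: by end_near. Qed.

Lemma ac_cvg_right : cvg (f y @[y --> b^'-]).
Proof.
apply: cauchy_cvg; apply: cauchy_exP => e e0.
have [d d0 dP] := ac_uniform_abs e0.
have [m [m0 md mb]] := gt0_lower_bound d0 ba0.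
exists (f (b - m / 2)).
suff : \forall y \near b^'-, `|f (b - m / 2) - f y| < e by [].
near=> y; apply: dP.
- have : y < b by [].
  have : b - m / 2 < y by near: y; apply: nbhs_left_gt; lra.
  by move=> *; apply/andP; split; lra.
- by apply/andP; split; lra.
- have : y < b by [].
  have : b - m / 2 < y by near: y; apply: nbhs_left_gt; lra.
  by move=> *; rewrite ltr_norml; apply/andP; split; lra.
Unshelve. all: by end_near. Qed.

(** Continuous extension of f from ]a, b[ to [a, b], constant outside.  It
    stands for f in the variations on [a, b], which must not see the jumps of f
    at a and b. *)
Definition arc_extension x :=
  if x <= a then lim (f y @[y --> a^'+])
  else if b <= x then lim (f y @[y --> b^'-]) else f x.
Local Notation fh := arc_extension.

Lemma arc_extension_in x : a < x < b -> fh x = f x.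
Proof. by move=> /andP[ax xb]; rewrite /fh !leNgt ax xb. Qed.

(** Uniform continuity on ]a, b[ passes to the extension: the limits at the end
    points inherit the modulus of continuity. *)
Lemma ac_extension_clamp e : 0 < e -> exists2 h : R, 0 < h &
  forall h', 0 < h' < h ->
  [/\ a < a + h' < b, a < b - h' < b &
   forall x, a <= x <= b ->
    `|fh (Num.max (a + h') (Num.min (b - h') x)) - fh x| <= e].
Proof.
move=> e0; have [d d0 dP] := ac_uniform_abs e0.
have [m [m0 md mb]] := gt0_lower_bound d0 ba0.
exists (m / 2) => [|h' /andP[h0 hm]]; first lra.
have c1 : a < a + h' < b by apply/andP; split; lra.
have c2 : a < b - h' < b by apply/andP; split; lra.
split=> // x /andP[ax xb].
have fha : fh a = lim (f y @[y --> a^'+]) by rewrite /fh lexx.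
have fhb : fh b = lim (f y @[y --> b^'-]) by rewrite /fh lexx leNgt ab.
have [xs|xs] := leP x (b - h'); last first.
  rewrite max_r; last lra.
  rewrite (arc_extension_in c2).
  have close y : b - h' < y -> y < b -> `|f (b - h') - f y| < e.
    move=> *; apply: dP => //; first by apply/andP; split; lra.
    by rewrite ltr_norml; apply/andP; split; lra.
  have near_b : \forall y \near b^'-, b - h' < y by apply: nbhs_left_gt; lra.
  have [->|xb'] := eqVneq x b; last first.
    have {}xb : x < b by rewrite lt_neqAle xb' xb.
    rewrite arc_extension_in; last by apply/andP; split; lra.
    by apply/ltW/close.
  rewrite fhb ler_distlC; apply/andP; split.
    apply: limr_ge; first exact: ac_cvg_right.
    near=> y; have /ltr_distlBl/ltW// : `|f (b - h') - f y| < e.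
    by apply: close => //; near: y.
  apply: limr_le; first exact: ac_cvg_right.
  near=> y; have /ltr_distlCDr/ltW// : `|f (b - h') - f y| < e.
  by apply: close => //; near: y.
have [xs'|xs'] := leP (a + h') x; first by rewrite subrr normr0 ltW.
rewrite (arc_extension_in c1).
have close y : a < y -> y < a + h' -> `|f (a + h') - f y| < e.
  move=> *; apply: dP => //; first by apply/andP; split; lra.
  by rewrite ltr_norml; apply/andP; split; lra.
have near_a : \forall y \near a^'+, y < a + h' by apply: nbhs_right_lt; lra.
have [->|xa'] := eqVneq x a; last first.
  have {}ax : a < x by rewrite lt_neqAle eq_sym xa' ax.
  rewrite arc_extension_in; last by apply/andP; split; lra.
  by apply/ltW/close.
rewrite fha ler_distlC; apply/andP; split.
  apply: limr_ge; first exact: ac_cvg_left.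
  near=> y; have /ltr_distlBl/ltW// : `|f (a + h') - f y| < e.
  by apply: close => //; near: y.
apply: limr_le; first exact: ac_cvg_left.
near=> y; have /ltr_distlCDr/ltW// : `|f (a + h') - f y| < e.
by apply: close => //; near: y.
Unshelve. all: by end_near. Qed.

(** Absolute continuity up to the end points, for some of the cells between
    consecutive nodes.  The nodes are first pushed inside ]a, b[ by a monotone
    contraction, which keeps the cells disjoint and does not lengthen them; the
    discarded cells are collapsed to empty intervals. *)
Lemma ac_nodes e : 0 < e -> exists2 d : R, 0 < d &
  forall (n : nat) (p : nat -> R) (P : pred nat),
    (forall i, (i < n)%N -> p i <= p i.+1) -> a <= p 0%N -> p n <= b ->
    \sum_(i < n | P i) (p i.+1 - p i) < d ->
    \sum_(i < n | P i) `|fh (p i.+1) - fh (p i)| <= e.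
Proof.
move=> e0; have e2 : 0 < e / 2 by rewrite divr_gt0.
have [d d0 dP] := acf e2; exists d => // n p P pS ap pb pd.
have pmono i j : (i <= j)%N -> (j <= n)%N -> p i <= p j by exact: nodes_mono.
have pin i : (i <= n)%N -> a <= p i <= b.
  by move=> ni; rewrite (le_trans ap) ?(le_trans _ pb)// pmono.
pose k := e / 4 / n.+1%:R; have k0 : 0 < k by rewrite !divr_gt0.
have [h h0 hP] := ac_extension_clamp k0.
have [|c1 c2 {hP h0}hP] := hP (h / 2); first by apply/andP; split; lra.
set h' := h / 2 in c1 c2 hP.
pose cl x := Num.max (a + h') (Num.min (b - h') x).
have cl_in x : a < cl x < b.
  move: c1 c2 => /andP[? ?] /andP[? ?].
  rewrite /cl lt_max gt_max; apply/and3P; split; [by apply/orP; left|by []|].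
  by rewrite gt_min; apply/orP; left.
have cl_le x y : x <= y -> cl x <= cl y by exact: clamp_le.
have cl_sub x y : x <= y -> cl y - cl x <= y - x by exact: clamp_sub.
pose u (i : 'I_n) := cl (p i); pose v (i : 'I_n) := if P i then cl (p i.+1) else u i.
have small : \sum_(i < n) `|f (v i) - f (u i)| < e / 2.
apply: dP.
- move=> i; rewrite !in_itv/= /v /u; split.
  + exact: cl_in.
  + by case: ifP => _; exact: cl_in.
  + by case: ifP => _; rewrite ?lexx// cl_le// pS.
- move=> i j _ _ [x []] /=; rewrite !in_itv/= /u /v => /andP[uix xvi] /andP[ujx xvj].
  apply/val_inj/eqP; rewrite eqn_leq; apply/andP; split; rewrite leqNgt; apply/negP => lt_ij.
    move: xvj uix; case: ifP => _ A B; last by rewrite /u in A; lra.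
    have := cl_le _ _ (pmono j.+1 i lt_ij (ltnW (ltn_ord i))); lra.
  move: xvi ujx; case: ifP => _ A B; last by rewrite /u in A; lra.
  by have := cl_le _ _ (pmono i.+1 j lt_ij (ltnW (ltn_ord j))); lra.
- apply: le_lt_trans pd; rewrite [leRHS]big_mkcond/=; apply: ler_sum => i _.
  by rewrite /v /u; case: ifP => _; rewrite ?subrr// cl_sub// pS.
apply: (@le_trans _ _ (\sum_(i < n) (`|f (v i) - f (u i)| + 2 * k))).
  rewrite big_mkcond/=; apply: ler_sum => i _; rewrite /v /u; case: ifP => _; last first.
    by rewrite subrr normr0 add0r; lra.
  have := hP _ (pin i (ltnW (ltn_ord i))); have := hP _ (pin i.+1 (ltn_ord i)).
  rewrite -/(cl (p i)) -/(cl (p i.+1)) !(arc_extension_in (cl_in _)).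
  move: (f _) (f _) (fh _) (fh _) => A C B D.
  rewrite distrC => BA DC.
  by have := ler_distD C D B; have := ler_distD A C B; lra.
rewrite big_split/= sumr_const card_ord -mulr_natl.
have nk : n%:R * (2 * k) <= e / 2.
  have -> : n%:R * (2 * k) = (n%:R / n.+1%:R) * (e / 2).
    have : n.+1%:R != 0 :> R by rewrite pnatr_eq0.
    by rewrite /k; move: (n.+1%:R : R) => N N0; field.
  by rewrite ler_piMl ?(ltW e2)// ltW// ltr_pdivrMr// mul1r ltr_nat.
lra.
Qed.

End absolutely_continuous_arc.

(** * Partitions that nearly exhaust several total variations *)

Section partitions.
Variable R : realType.
Implicit Types (a b c x y u v : R) (g : R -> R) (t : seq R) (p : nat -> R).

Lemma itv_partition_nodes a b t : itv_partition a b t ->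
  let p := nth b (a :: t) in
  [/\ p 0%N = a, p (size t) = b & forall i, (i < size t)%N -> p i < p i.+1].
Proof.
move=> /[dup] abt [/(pathP b) pt tb]; split=> //.
exact: itv_partition_nth_size.
Qed.

Lemma itv_partition_bounds a b t x : itv_partition a b t -> x \in t -> a < x <= b.
Proof.
move=> /[dup] abt [/lt_path_min/allP at_ _] xt; rewrite at_//=.
rewrite -(nth_index b xt) -[nth _ _ _]/(nth b (a :: t) (index x t).+1).
by apply: itv_partition_nth_le => //; rewrite ltnS index_mem.
Qed.

Lemma itv_partition_merge a b t1 t2 : a < b ->
  itv_partition a b t1 -> itv_partition a b t2 ->
  exists t, [/\ itv_partition a b t, subseq t1 t & subseq t2 t].
Proof.
move=> ab abt1 abt2.
pose t0 := sort <=%O (undup [seq x <- t1 ++ t2 | x < b]).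
have mem0 x : x \in t0 = (x < b) && ((x \in t1) || (x \in t2)).
  by rewrite mem_sort mem_undup mem_filter mem_cat.
have t0s : sorted <%O t0 by rewrite sort_lt_sorted undup_uniq.
have at0 : all (> a) t0.
  apply/allP => x; rewrite mem0 => /andP[_ /orP[|]].
    by move=> /(itv_partition_bounds abt1)/andP[].
  by move=> /(itv_partition_bounds abt2)/andP[].
have abt : itv_partition a b (rcons t0 b).
  split; last by rewrite last_rcons.
  rewrite rcons_path lt_path_sortedE at0 t0s/=.
  have : last a t0 \in a :: t0 by exact: mem_last.
  by rewrite inE => /orP[/eqP ->//|]; rewrite mem0 => /andP[].
have sub t : itv_partition a b t -> {subset t <= rcons t0 b} -> subseq t (rcons t0 b).
  move=> abt' st; suff -> : t = [seq x <- rcons t0 b | x \in t] by exact: filter_subseq.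
  have sr : sorted <%O (rcons t0 b) by case: abt => /path_sorted.
  apply: lt_sorted_eq; first by case: abt' => /path_sorted.
    by apply: sorted_filter => //; exact: lt_trans.
  move=> x; rewrite mem_filter; case: (boolP (x \in t)) => //= /st.
  by move=> ->.
exists (rcons t0 b); split => //; apply: sub => // x xt;
  rewrite mem_rcons inE mem0 xt ?orbT andbT -le_eqVlt.
  by have /andP[] := itv_partition_bounds abt1 xt.
by have /andP[] := itv_partition_bounds abt2 xt.
Qed.

(** For g of bounded variation on an interval that starts at a, a nondecreasing
    function of x whose increments dominate those of g. *)
Definition variation_function a g x : R := fine (total_variation a x g).

Lemma total_variation_fin a b g u v : a <= u -> u <= v -> v <= b ->
  bounded_variation a b g -> total_variation u v g \is a fin_num.
Proof.
move=> au uv vb abg; apply/bounded_variationP => //.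
exact: (bounded_variationl uv vb (bounded_variationr au (le_trans uv vb) abg)).
Qed.

Lemma variation_function_increment a b g u v : bounded_variation a b g ->
  a <= u -> u <= v -> v <= b -> `|g v - g u| <= variation_function a g v - variation_function a g u.
Proof.
move=> abg au uv vb; have ub := le_trans uv vb.
rewrite -lee_fin (le_trans (total_variation_ge g uv))//.
rewrite /variation_function (total_variationD g au uv) fineD ?(total_variation_fin _ _ _ abg)//.
by rewrite addrAC subrr add0r fineK ?(total_variation_fin _ _ _ abg).
Qed.

(** Refining a partition can only increase variations, so the partitions obtained
    for the single functions can be merged into one that serves all. *)
Lemma near_optimal_partition (I : eqType) (F : I -> R -> R) a b (s : seq I) eta :
  a < b -> 0 < eta -> (forall i, i \in s -> bounded_variation a b (F i)) ->
  exists t, itv_partition a b t /\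
    forall i, i \in s -> variation_function a (F i) b - eta <= variation a b (F i) t.
Proof.
move=> ab eta0; elim: s => [_|i s IH bvF].
  by exists [:: b]; split => //; exact: itv_partition1.
have [j js|t1 [abt1 t1P]] := IH; first by apply: bvF; rewrite inE js orbT.
have bvi : bounded_variation a b (F i) by apply: bvF; rewrite mem_head.
have supi : has_sup (variations a b (F i)) by split => //; exact: variations_neq0.
have [_ [t2 abt2 <-] t2P] := sup_adherent eta0 supi.
have [t [abt st1 st2]] := itv_partition_merge ab abt1 abt2.
exists t; split=> // j; rewrite inE => /orP[/eqP ->|js]; last first.
  by rewrite (le_trans (t1P _ js))// variation_subseq.
rewrite /variation_function /total_variation ereal_sup_EFin//=; last exact: variations_neq0.
by rewrite ltW// (lt_le_trans t2P)// variation_subseq.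
Qed.

End partitions.

Section absolutely_continuous_bv.
Variables (R : realType) (a b : R) (f : R -> R).
Hypotheses (ab : a < b) (acf : abs_continuous `]a, b[ f).
Local Notation fh := (arc_extension a b f).

(** Pieces shorter than the d given by absolute continuity for e = 1 have variation
    at most 1, and finitely many of them make up the arc. *)
Lemma ac_bounded_variation : bounded_variation a b fh.
Proof.
have [d d0 dP] := ac_nodes ab acf (@ltr01 R).
have small c c' : a <= c -> c <= c' -> c' <= b -> c' - c < d ->
    total_variation c c' fh \is a fin_num.
  move=> ac cc' c'b cd; apply/bounded_variationP => //.
  exists 1 => _ [t cct <-]; rewrite /variation big_mkord.
  have [p0 pn pS] := itv_partition_nodes cct.
  apply: (dP _ (nth c' (c :: t)) predT).
  - by move=> i /pS/ltW.
  - by rewrite p0.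
  - by rewrite pn.
  - rewrite -(big_mkord predT (fun i => nth c' (c :: t) i.+1 - nth c' (c :: t) i)).
    by rewrite telescope_sumr// pn p0.
have step m : forall c c', a <= c -> c <= c' -> c' <= b -> c' - c <= m%:R * (d / 2) ->
    total_variation c c' fh \is a fin_num.
  elim: m => [|m IH] c c' ac cc' c'b; first by rewrite mul0r => ?; apply: small => //; lra.
  rewrite -natr1 mulrDl mul1r => le.
  have [cd|cd] := ltP (c' - c) d; first exact: small.
  rewrite (@total_variationD _ c c' (c' - d / 2))//; [|lra|lra].
  by rewrite fin_numD; apply/andP; split; [apply: IH|apply: small]; lra.
apply/bounded_variationP; first exact: ltW.
apply: (step (Num.truncn ((b - a) / (d / 2))).+1) => //; first exact: ltW.
by rewrite -ler_pdivrMr ?divr_gt0// ltW// truncnS_gt.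
Qed.

Lemma ac_slope_bounded_variation (s : R) : bounded_variation a b (fun x => fh x - s * x).
Proof.
apply: (@bounded_variationD _ a b fh (fun x => - (s * x))) => //.
  exact: ac_bounded_variation.
apply: (@bounded_variationN _ a b (fun x => s * x)).
have [s0|s0] := leP 0 s.
  apply: nondecreasing_bounded_variation => x y _ _ xy; exact: ler_wpM2l.
rewrite (_ : (fun _ => _) = \- (fun x => - s * x)).
  apply: bounded_variationN; apply: nondecreasing_bounded_variation => x y _ _ xy.
  by apply: ler_wpM2l => //; rewrite oppr_ge0 ltW.
by apply/funext => x /=; rewrite mulNr opprK.
Qed.

End absolutely_continuous_bv.

(** * Approximation by step slopes up to small variation *)

Section piecewise_linear_approximation.
Variables (R : realType) (a b : R) (f : R -> R).
Hypotheses (ab : a < b) (acf : abs_continuous `]a, b[ f).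
Local Notation fh := (arc_extension a b f).
Implicit Types (d e x y u v s M tau delta : R) (p : nat -> R).

Lemma slope_grid M tau : 0 < M -> 0 < tau -> exists G : seq R,
  0 \in G /\ forall s, `|s| <= M -> exists2 s', s' \in G & `|s - s'| <= tau.
Proof.
move=> M0 tau0; pose K := (Num.truncn (2 * M / tau)).+1.
exists (0 :: [seq k%:R * tau - M | k <- iota 0 K]); split; first exact: mem_head.
move=> s; rewrite ler_norml => /andP[s1 s2]; pose k := Num.truncn ((s + M) / tau).
exists (k%:R * tau - M).
  rewrite inE; apply/orP; right; apply/mapP; exists k => //.
  rewrite mem_iota/= add0n ltnS; apply: le_truncn.
  by rewrite ler_wpM2r ?invr_ge0 ?(ltW tau0)//; lra.
have /andP[] : k%:R <= (s + M) / tau < k.+1%:R.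
  by apply: truncn_itv; rewrite divr_ge0 ?(ltW tau0)//; lra.
rewrite ler_pdivlMr// ltr_pdivrMr// -natr1 mulrDl mul1r => ? ?.
by rewrite ler_norml; apply/andP; split; lra.
Qed.

Lemma le_sum_seq_mem (I : eqType) (r : seq I) (F : I -> R) i :
  i \in r -> (forall j, j \in r -> 0 <= F j) -> F i <= \sum_(j <- r) F j.
Proof.
move=> ir F0; rewrite (big_rem i)//= lerDl big_seq sumr_ge0// => j /mem_rem.
exact: F0.
Qed.

(** The core of the approximation; T i dominates the error on the cell i.  Its total
    growth is estimated on a partition that is nearly optimal for all slopes of
    the grid: the excess of the variations over the moduli of the increments is
    at most delta / 2 in total.  The increments contribute tau times the lengths,
    hence delta / 4, and delta / 4 for the steep cells: their total length is
    below d, as the sum of the moduli of the increments of f is at most V. *)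
Lemma ac_cell_slopes delta : 0 < delta ->
  exists (n : nat) (p : nat -> R) (sg : nat -> R) (T : nat -> R -> R),
  [/\ p 0%N = a, p n = b, forall i, (i < n)%N -> p i < p i.+1,
    forall i u v, (i < n)%N -> p i <= u -> u <= v -> v <= p i.+1 ->
      `|fh v - fh u - sg i * (v - u)| <= T i v - T i u &
    \sum_(i < n) (T i (p i.+1) - T i (p i)) <= delta].
Proof.
move=> delta0; have delta4 : 0 < delta / 4 by rewrite divr_gt0.
have [d d0 dP] := ac_nodes ab acf delta4.
have bvf := ac_bounded_variation ab acf.
pose V := variation_function a fh b.
have V0 : 0 <= V by rewrite fine_ge0// total_variation_ge0// ltW.
(* chord slopes beyond M occur on a total length of at most V / M < d *)
pose M := V / d + 1; have M0 : 0 < M by rewrite ltr_wpDl// divr_ge0// ltW.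
have ba0 : 0 < b - a by rewrite subr_gt0.
pose tau := delta / 4 / (b - a); have tau0 : 0 < tau by rewrite divr_gt0.
have [G [G0 GP]] := slope_grid M0 tau0.
have sG0 : 0 < (size G)%:R :> R by rewrite ltr0n; case: (G) G0.
pose eta := delta / 2 / (size G)%:R; have eta0 : 0 < eta by rewrite !divr_gt0.
pose F s x := fh x - s * x.
have bvF s : bounded_variation a b (F s) by exact: ac_slope_bounded_variation.
have [t [abt tP]] := near_optimal_partition ab eta0 (fun s (_ : s \in G) => bvF s).
have [] := itv_partition_nodes abt.
set p := nth b (a :: t) in tP *; set n := size t in tP * => p0 pn pS.
have pmono i j : (i <= j)%N -> (j <= n)%N -> p i <= p j by exact: nodes_le.
have pa i : (i <= n)%N -> a <= p i by move=> ?; rewrite -p0 pmono.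
have pb i : (i <= n)%N -> p i <= b by move=> ?; rewrite -pn pmono.
pose D i := fh (p i.+1) - fh (p i); pose l i := p i.+1 - p i.
have l0 i : (i < n)%N -> 0 < l i by move=> ?; rewrite subr_gt0 pS.
pose steep i := M * l i < `|D i|.
have /choice[sg sgP] : forall i, exists s, s \in G /\ ((i < n)%N ->
    `|D i - s * l i| <= tau * l i + (if steep i then `|D i| else 0)).
  move=> i; have [ni|] := boolP (i < n)%N; last by exists 0.
  have l0i := l0 i ni; have l0N : l i != 0 by rewrite gt_eqF.
  case: ifP => st.
    exists 0; split=> // _; rewrite mul0r subr0 lerDr mulr_ge0// ltW//.
  have /GP[s sG sP] : `|D i / l i| <= M.
    rewrite normrM normfV (gtr0_norm l0i) ler_pdivrMr// leNgt; exact: negbT.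
  exists s; split=> // _; rewrite addr0.
  have -> : D i - s * l i = (D i / l i - s) * l i by field.
  by rewrite normrM (gtr0_norm l0i) ler_wpM2r// ltW.
exists n, p, sg, (fun i => variation_function a (F (sg i))); split=> //.
  move=> i u v ni iu uv vi.
  have -> : fh v - fh u - sg i * (v - u) = F (sg i) v - F (sg i) u by rewrite /F; ring.
  apply: variation_function_increment (bvF _) _ uv _; first exact: le_trans (pa i (ltnW ni)) iu.
  exact: le_trans vi (pb _ ni).
(* near optimality of the partition bounds the sum of gap s i over the cells i *)
pose gap s i := (variation_function a (F s) (p i.+1) - variation_function a (F s) (p i))
  - `|F s (p i.+1) - F s (p i)|.
have gap0 s i : (i < n)%N -> 0 <= gap s i.
  move=> ni; rewrite subr_ge0; apply: variation_function_increment (bvF _) _ _ _.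
  - exact/pa/ltnW.
  - exact/ltW/pS.
  - exact: pb.
have gapG : \sum_(i < n) \sum_(s <- G) gap s i <= delta / 2.
  rewrite exchange_big/= (@le_trans _ _ (\sum_(s <- G) eta))//; last first.
    by rewrite big_const_seq count_predT iter_addr_0 -[X in X <= _]mulr_natr /eta divfK// gt_eqF.
  rewrite big_seq [leRHS]big_seq; apply: ler_sum => s sG.
  rewrite sumrB -(big_mkord predT (fun i => variation_function a (F s) (p i.+1)
    - variation_function a (F s) (p i))).
  rewrite telescope_sumr// pn p0 {2}/variation_function total_variationxx/= subr0.
  rewrite -(big_mkord predT (fun i => `|F s (p i.+1) - F s (p i)|)).
  have : variation_function a (F s) b - eta
      <= \sum_(0 <= i < n) `|F s (p i.+1) - F s (p i)| := tP s sG.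
  lra.
have suml : \sum_(i < n) l i = b - a.
  by rewrite -(big_mkord predT l) telescope_sumr// pn p0.
have steep_len : \sum_(i < n | steep i) l i < d.
  have : M * (\sum_(i < n | steep i) l i) <= V.
    rewrite mulr_sumr (@le_trans _ _ (\sum_(i < n) `|D i|))//.
      rewrite big_mkcond/=; apply: ler_sum => i _; case: ifP => // /ltW //.
    rewrite (@le_trans _ _ (\sum_(i < n) (variation_function a fh (p i.+1)
      - variation_function a fh (p i))))//.
      apply: ler_sum => i _; apply: variation_function_increment bvf _ _ _.
      - exact/pa/ltnW.
      - exact/ltW/pS.
      - exact: pb.
    rewrite -(big_mkord predT (fun i => variation_function a fh (p i.+1)
      - variation_function a fh (p i))).
    by rewrite telescope_sumr// pn p0 {2}/variation_function total_variationxx/= subr0.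
  rewrite -ler_pdivlMl// => /le_lt_trans; apply.
  by rewrite ltr_pdivrMl// /M mulrDl divfK ?gt_eqF// mul1r ltrDl.
have steep_var : \sum_(i < n | steep i) `|D i| <= delta / 4.
  by apply: dP; rewrite ?p0 ?pn// => i ni; exact/ltW/pS.
apply: (@le_trans _ _ (\sum_(i < n) (tau * l i + (if steep i then `|D i| else 0)
                        + \sum_(s <- G) gap s i))).
  apply: ler_sum => i _; have [sG sD] := sgP i.
  have := le_sum_seq_mem sG (fun s _ => gap0 s i (ltn_ord i)); rewrite /gap.
  have -> : F (sg i) (p i.+1) - F (sg i) (p i) = D i - sg i * l i by rewrite /F /D /l; ring.
  by have := sD (ltn_ord i); lra.
rewrite !big_split/= -mulr_sumr suml -big_mkcond/=.
have -> : tau * (b - a) = delta / 4 by rewrite /tau divfK// gt_eqF.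
lra.
Qed.

End piecewise_linear_approximation.

Section arc_approximation.
Variables (R : realType) (alpha : R).
Implicit Types (a b d e x y u v s delta : R) (p : nat -> R).

Lemma locate_node p n x : p 0%N <= x -> x < p n ->
  exists2 i, (i < n)%N & p i <= x < p i.+1.
Proof.
move=> p0x; elim: n => [|n IH] xn; first lra.
have [xp|px] := ltP x (p n); last by exists n; rewrite ?px.
by have [i ni] := IH xp; exists i => //; exact: ltnW.
Qed.

(** The lifted arcs are disjoint when the nodes lie in a window of length 1, so
    that a single indicator survives. *)
Lemma step_function_value p n (sg : nat -> R) i x :
  (forall i, (i < n)%N -> p i < p i.+1) -> p n <= p 0%N + 1 ->
  (i < n)%N -> p i <= x < p i.+1 ->
  \sum_(j < n) sg j * arc_indicator (p j) (p j.+1) x = sg i.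
Proof.
move=> pS pn ni /andP[ix xi].
have a_le j : (j <= n)%N -> p 0%N <= p j by move=> jn; exact: (nodes_le pS).
have le_b j : (j <= n)%N -> p j <= p n by move=> jn; exact: (nodes_le pS).
have i1 : p i.+1 <= p i + 1 by have := le_b i.+1 ni; have := a_le i (ltnW ni); lra.
rewrite (bigD1 (Ordinal ni))//= arc_indicator_in ?ix// mulr1 big1 ?addr0//.
move=> j; rewrite -(inj_eq val_inj)/= neq_ltn => jNi.
have jn := ltn_ord j; have := pS j jn.
have := le_b _ jn; have := a_le j (ltnW jn); have := a_le i (ltnW ni).
have := le_b _ ni => *.
case/orP: jNi => lt; [rewrite arc_indicator_right ?mulr0//|rewrite arc_indicator_left ?mulr0//].
- by have := nodes_le pS lt (ltnW ni); lra.
- by lra.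
- by lra.
- by have := nodes_le pS lt (ltnW jn); lra.
- by apply/andP; split; lra.
Qed.

(** The functions T i of [ac_cell_slopes] are glued by clamping the argument to the
    cells.  Close points u <= v in different cells are separated by a node: there
    Lam jumps by kap, which dominates |f v - f u| and |sg u (v - u)| for close
    points, while all the jumps together cost at most delta / 2. *)
Lemma arc_approximation a b (f : R -> R) delta : irrational alpha ->
  a < b -> b <= a + 1 -> abs_continuous `]a, b[ f -> 0 < delta ->
  exists (sg Lam : R -> R) (c d : R),
  [/\ 0 < d, uniformly_averages_to alpha sg c &
      `|c - (arc_extension a b f b - arc_extension a b f a)| <= delta] /\
  [/\ forall x (z : int), sg (x + z%:~R) = sg x &
      forall x, b <= x -> x < a + 1 -> sg x = 0] /\
  [/\ forall x y, x <= y -> Lam x <= Lam y, forall x, x <= a -> Lam x = 0,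
      forall x, b <= x -> Lam x = Lam b & Lam b <= delta] /\
  forall u v, a < u -> u <= v -> v < b -> v - u < d ->
    `|f v - f u - sg u * (v - u)| <= Lam v - Lam u.
Proof.
move=> irr ab ba1 acf delta0; set fh := arc_extension a b f.
have delta2 : 0 < delta / 2 by rewrite divr_gt0.
have [n [p [s [T [p0 pn pS sT sumT]]]]] := ac_cell_slopes ab acf delta2.
have n0 : (0 < n)%N.
  by rewrite lt0n; apply/eqP => n0; move: ab; rewrite -p0 -pn n0 ltxx.
have nR0 : 0 < n%:R :> R by rewrite ltr0n.
have pa i : (i <= n)%N -> a <= p i by move=> ?; rewrite -p0 (nodes_le pS).
have pb i : (i <= n)%N -> p i <= b by move=> ?; rewrite -pn (nodes_le pS).
pose kap := delta / 2 / n%:R; have kap0 : 0 < kap by rewrite divr_gt0.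
pose sg x := \sum_(i < n) s i * arc_indicator (p i) (p i.+1) x.
pose cl i x := Num.max (p i) (Num.min (p i.+1) x).
pose jump i x := if (0 < i)%N && (p i <= x) then kap else 0.
pose Lam x := \sum_(i < n) (T i (cl i x) - T i (p i) + jump i x).
have cl_itv i x : (i < n)%N -> p i <= cl i x <= p i.+1.
  by move=> /pS/ltW ni; rewrite /cl le_max lexx/= ge_max ni ge_min lexx.
have cl_in i x : p i <= x -> x <= p i.+1 -> cl i x = x.
  by move=> ix xi; rewrite /cl min_r// max_r.
have cl_lo i x : (i < n)%N -> x <= p i -> cl i x = p i.
  by move=> /pS ni xi; rewrite /cl min_r ?(le_trans xi) ?ltW// max_l.
have cl_hi i x : (i < n)%N -> p i.+1 <= x -> cl i x = p i.+1.
  by move=> /pS ni xi; rewrite /cl min_l// max_r// ltW.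
have T_le i x y : (i < n)%N -> p i <= x -> x <= y -> y <= p i.+1 -> T i x <= T i y.
  by move=> ni ix xy yi; rewrite -subr_ge0 (le_trans _ (sT i x y ni ix xy yi)).
have jump_le i x y : x <= y -> jump i x <= jump i y.
  move=> xy; rewrite /jump; case: (0 < i)%N => //=.
  case: (leP (p i) x) => ix; last by case: ifP => // _; exact: ltW.
  by rewrite (le_trans ix xy).
have Tcl_le i x y : (i < n)%N -> x <= y -> T i (cl i x) <= T i (cl i y).
  move=> ni xy; have /andP[? _] := cl_itv i x ni; have /andP[_ ?] := cl_itv i y ni.
  by apply: T_le => //; exact: clamp_le.
have term_le x y i : x <= y -> (i < n)%N ->
    T i (cl i y) - T i (cl i x) + (jump i y - jump i x) <= Lam y - Lam x.
  move=> xy ni; rewrite /Lam -sumrB (bigD1 (Ordinal ni))//= [leLHS](_ : _ =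
    T i (cl i y) - T i (p i) + jump i y - (T i (cl i x) - T i (p i) + jump i x)); last by ring.
  rewrite lerDl sumr_ge0// => j _.
  by have := Tcl_le j x y (ltn_ord j) xy; have := jump_le j x y xy; lra.
have kap2 : 0 < kap / 2 by lra.
have [d1 d10 d1P] := ac_uniform acf kap2.
pose M := \sum_(i < n) `|s i| + 1.
have M0 : 0 < M by rewrite ltr_wpDl// sumr_ge0.
have sM i : (i < n)%N -> `|s i| <= M.
  move=> ni; rewrite /M (bigD1 (Ordinal ni))//= -addrA lerDl addr_ge0// sumr_ge0//.
have kM0 : 0 < kap / 2 / M by rewrite !divr_gt0.
have [d [d0 dd1 dM]] := gt0_lower_bound d10 kM0.
exists sg, Lam, (\sum_(i < n) s i * (p i.+1 - p i)), d.
split; [split=> // | split; [split | split; [split|]]].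
- apply: (uniformly_averages_to_sum (s := fun i x => s i * arc_indicator (p i) (p i.+1) x)
    (c := fun i => s i * (p i.+1 - p i))) => i _.
  exact/uniformly_averages_toZ/arc_indicator_equidistributed.
- have -> : fh b - fh a = \sum_(i < n) (fh (p i.+1) - fh (p i)).
    rewrite -(big_mkord predT (fun i => fh (p i.+1) - fh (p i))).
    by rewrite telescope_sumr// p0 pn.
  rewrite distrC -sumrB (le_trans (ler_norm_sum _ _ _))//.
  apply: (@le_trans _ _ (\sum_(i < n) (T i (p i.+1) - T i (p i)))); last lra.
  by apply: ler_sum => i _; apply: sT => //; exact/ltW/pS.
- by move=> x z; rewrite /sg; apply: eq_bigr => i _; rewrite arc_indicator_periodic.
- move=> x bx xa; rewrite /sg big1// => i _; rewrite arc_indicator_right ?mulr0//.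
  + by rewrite (le_trans _ bx)// pb.
  + exact/ltW/pS.
  + by rewrite (lt_le_trans xa)// lerD2r pa// ltnW.
- by move=> x y xy; rewrite -subr_ge0; apply: le_trans (term_le x y 0%N xy n0);
    have := Tcl_le 0%N x y n0 xy; have := jump_le 0%N x y xy; lra.
- move=> x xa; rewrite /Lam big1// => i _.
  rewrite cl_lo ?(le_trans xa) ?pa// ?subrr ?add0r 1?ltnW// /jump.
  case: (posnP i) => //= i0; rewrite leNgt (le_lt_trans xa)// -p0.
  by apply: (lt_le_trans (pS 0%N n0)); apply: (nodes_le pS) => //; exact: ltnW.
- move=> x bx; rewrite /Lam; apply: eq_bigr => i _.
  have ib := pb i (ltnW (ltn_ord i)); have Sib := pb i.+1 (ltn_ord i).
  by rewrite !cl_hi ?(le_trans Sib)// /jump ib (le_trans ib).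
- rewrite /Lam big_split/= [leRHS](splitr delta) lerD//.
    by apply: le_trans sumT; apply: ler_sum => i _; rewrite cl_hi ?pb.
  apply: (@le_trans _ _ (\sum_(i < n) kap)).
    by apply: ler_sum => i _; rewrite /jump; case: ifP => // _; exact: ltW.
  by rewrite sumr_const card_ord -[X in X <= _]mulr_natr /kap divfK// gt_eqF.
- move=> u v au uv vb vud.
  have [||i ni iu] := @locate_node p n u; [by rewrite p0 ltW|by rewrite pn (le_lt_trans uv)|].
  have -> : sg u = s i by apply: (step_function_value s pS _ ni iu); rewrite p0 pn.
  have /andP[iu1 iu2] := iu.
  have [vi|iv] := ltP v (p i.+1).
    have vi' := ltW vi; have iv := le_trans iu1 uv.
    have := term_le u v i uv ni; rewrite !cl_in//; last exact: le_trans uv vi'.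
    have := sT i u v ni iu1 uv vi'; have := jump_le i u v uv.
    rewrite !arc_extension_in; [|by rewrite au (le_lt_trans uv)|by rewrite vb (lt_le_trans au)].
    lra.
  have ni1 : (i.+1 < n)%N.
    rewrite ltn_neqAle ni andbT; apply/eqP => in1.
    by move: iv; rewrite in1 pn leNgt vb.
  have := term_le u v i.+1 uv ni1; have := Tcl_le i.+1 u v ni1 uv.
  rewrite /jump/= iv (leNgt (p i.+1) u) iu2/=.
  have := d1P u v au uv vb (lt_le_trans vud dd1).
  have : `|s i * (v - u)| <= kap / 2.
    rewrite normrM (ger0_norm (_ : 0 <= v - u)) ?subr_ge0//.
    apply: (@le_trans _ _ (M * (kap / 2 / M))); last by rewrite mulrC divfK// gt_eqF.
    by apply: ler_pM => //; [rewrite subr_ge0|exact: sM|exact: le_trans (ltW vud) dM].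
  have := ler_normB (f v - f u) (s i * (v - u)).
  lra.
Qed.

End arc_approximation.

(** * From one arc to the whole circle *)

Section circle_approximation.
Variables (R : realType) (f : R -> R) (k : nat) (beta : nat -> R).
Hypotheses (f_circle : circle_function f) (f_pw_ac : pw_abs_continuous f k beta).
Implicit Types (a b d e x y u v delta : R).

Lemma circle_function_int x (z : int) : f (x + z%:~R) = f x.
Proof.
have nat_case (n : nat) y : f (y + n%:R) = f y.
  elim: n => [|n IH]; first by rewrite addr0.
  by rewrite -natr1 addrA f_circle.
case: z => n; first exact: nat_case.
by rewrite NegzE rmorphN/= -{2}(subrK (n.+1%:R) x) nat_case.
Qed.

Lemma circle_function_lim_left x : lim (f y @[y --> (x + 1)^'-]) = lim (f y @[y --> x^'-]).
Proof.
congr (lim _); apply/seteqP; split => A /=.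
  rewrite /fmap/= /at_left /within/= => /nbhs_ballP[e /= e0 eA].
  apply/nbhs_ballP; exists e => // y xy yx; suff : A (f (y + 1)) by rewrite f_circle.
  apply: eA; last by rewrite ltrD2r.
  by move: xy; rewrite /ball/=; congr (`| _ | < _); ring.
rewrite /fmap/= /at_left /within/= => /nbhs_ballP[e /= e0 eA].
apply/nbhs_ballP; exists e => // y xy yx.
suff : A (f (y - 1)) by rewrite -f_circle subrK.
apply: eA; last by rewrite ltrBlDr.
by move: xy; rewrite /ball/=; congr (`| _ | < _); ring.
Qed.

Let k0 : (0 < k)%N. Proof. by case: f_pw_ac. Qed.
Let bk : beta k = beta 0%N + 1. Proof. by case: f_pw_ac. Qed.
Let bS j : (j < k)%N -> beta j < beta j.+1. Proof. by case: f_pw_ac => _ _ + _; exact. Qed.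

(** Summation by parts around the circle regroups the one-sided limits by arcs. *)
Lemma sum_of_jumps_increments : sum_of_jumps f k beta =
  \sum_(j < k) (arc_extension (beta j) (beta j.+1) f (beta j.+1)
              - arc_extension (beta j) (beta j.+1) f (beta j)).
Proof.
pose L j := lim (f y @[y --> (beta j)^'-]).
have Lk : L k = L 0%N by rewrite /L bk circle_function_lim_left.
have L0 : \sum_(j < k) (L j.+1 - L j) = 0.
  by rewrite -(big_mkord predT (fun j => L j.+1 - L j)) telescope_sumr// Lk subrr.
apply/eqP; rewrite -subr_eq0 -oppr_eq0 opprB -sumrB -[X in _ == X]L0.
apply/eqP/eq_bigr => j _.
by rewrite /arc_extension lexx leNgt bS//= lexx /L; ring.
Qed.

Lemma finite_lower_bound (n : nat) (d : nat -> R) :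
  (forall j, (j < n)%N -> 0 < d j) ->
  exists2 m : R, 0 < m & forall j, (j < n)%N -> m <= d j.
Proof.
elim: n => [_|n IH d0]; first by exists 1.
have [j jn|m m0 mP] := IH; first exact/d0/ltnW.
have [m' [m'0 m'm m'n]] := gt0_lower_bound m0 (d0 n (ltnSn n)).
exists m' => // j; rewrite ltnS leq_eqVlt => /orP[/eqP ->//|jn].
exact: le_trans m'm (mP _ jn).
Qed.

Theorem circle_approximation (alpha delta : R) : irrational alpha -> 0 < delta ->
  exists (sg Lam : R -> R) (c D d : R),
  [/\ 0 < d, uniformly_averages_to alpha sg c & `|c - sum_of_jumps f k beta| <= delta] /\
  [/\ D <= delta, forall x, Lam (x + 1) = Lam x + D &
      forall x y, x <= y -> Lam x <= Lam y] /\
  forall (j : nat) (z : int) u v, (j < k)%N ->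
    z%:~R + beta j < u -> u <= v -> v < z%:~R + beta j.+1 -> v - u < d ->
    `|f v - f u - sg u * (v - u)| <= Lam v - Lam u.
Proof.
move=> irr delta0.
have kR : 0 < k%:R :> R by rewrite ltr0n.
have dk0 : 0 < delta / k%:R by rewrite divr_gt0.
have b_le i j : (i <= j)%N -> (j <= k)%N -> beta i <= beta j by exact: nodes_le.
pose fh j := arc_extension (beta j) (beta j.+1) f.
have /choice[W WP] : forall j, exists w : (R -> R) * (R -> R) * R * R, (j < k)%N ->
  let: (sg, Lam, c, d) := w in
  [/\ 0 < d, uniformly_averages_to alpha sg c &
      `|c - (fh j (beta j.+1) - fh j (beta j))| <= delta / k%:R] /\
  [/\ forall x (z : int), sg (x + z%:~R) = sg x &
      forall x, beta j.+1 <= x -> x < beta j + 1 -> sg x = 0] /\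
  [/\ forall x y, x <= y -> Lam x <= Lam y, forall x, x <= beta j -> Lam x = 0,
      forall x, beta j.+1 <= x -> Lam x = Lam (beta j.+1) &
      Lam (beta j.+1) <= delta / k%:R] /\
  forall u v, beta j < u -> u <= v -> v < beta j.+1 -> v - u < d ->
    `|f v - f u - sg u * (v - u)| <= Lam v - Lam u.
  move=> j; have [jk|] := boolP (j < k)%N; last by exists ((idfun, idfun), 0, 0).
  have bj1 : beta j.+1 <= beta j + 1.
    by have := b_le _ _ jk (leqnn k); have := b_le 0%N j isT (ltnW jk); rewrite bk; lra.
  have acj : abs_continuous `]beta j, beta j.+1[ f by case: f_pw_ac => _ _ _; exact.
  have [sg [Lam [c [d H]]]] := arc_approximation irr (bS jk) bj1 acj dk0.
  by exists (sg, Lam, c, d).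
pose sgj j := (W j).1.1.1; pose Lj j := (W j).1.1.2; pose cj j := (W j).1.2.
pose dj j := (W j).2.
have {WP} WP j : (j < k)%N ->
  [/\ 0 < dj j, uniformly_averages_to alpha (sgj j) (cj j) &
      `|cj j - (fh j (beta j.+1) - fh j (beta j))| <= delta / k%:R] /\
  [/\ forall x (z : int), sgj j (x + z%:~R) = sgj j x &
      forall x, beta j.+1 <= x -> x < beta j + 1 -> sgj j x = 0] /\
  [/\ forall x y, x <= y -> Lj j x <= Lj j y, forall x, x <= beta j -> Lj j x = 0,
      forall x, beta j.+1 <= x -> Lj j x = Lj j (beta j.+1) &
      Lj j (beta j.+1) <= delta / k%:R] /\
  forall u v, beta j < u -> u <= v -> v < beta j.+1 -> v - u < dj j ->
    `|f v - f u - sgj j u * (v - u)| <= Lj j v - Lj j u.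
  by move=> /WP; rewrite /sgj /Lj /cj /dj; case: (W j) => [[[]]].
have [d d0 dP] := finite_lower_bound (fun j jk => let: conj (And3 h _ _) _ := WP j jk in h).
pose sg x := \sum_(j < k) sgj j x.
pose L0 x := \sum_(j < k) Lj j x; pose D := \sum_(j < k) Lj j (beta j.+1).
pose fl x := Num.floor (x - beta 0%N).
(* L0 takes the values 0 and D at the ends of a period; Lam repeats it *)
pose Lam x := (fl x)%:~R * D + L0 (x - (fl x)%:~R).
have LjS j x y : (j < k)%N -> x <= y -> Lj j x <= Lj j y.
  by move=> /WP[_ [_ [[h _ _ _] _]]]; exact: h.
have L0S x y : x <= y -> L0 x <= L0 y.
  by move=> xy; apply: ler_sum => j _; exact: LjS.
have L0b x : 0 <= L0 x <= D.
  apply/andP; split.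
    apply: sumr_ge0 => j _; have [_ [_ [[S lo _ _] _]]] := WP j (ltn_ord j).
    have [/lo ->//|/ltW h] := leP x (beta j).
    by rewrite -(lo _ (lexx _)); exact: S.
  apply: ler_sum => j _; have [_ [_ [[S _ hi _] _]]] := WP j (ltn_ord j).
  have [/hi ->//|/ltW h] := leP (beta j.+1) x; exact: S.
have flD x (z : int) : fl (x + z%:~R) = fl x + z by rewrite /fl addrAC floor_addint.
exists sg, Lam, (\sum_(j < k) cj j), D, d; split; [split|split; [split|]] => //.
- by apply: uniformly_averages_to_sum => j /WP[[]].
- rewrite sum_of_jumps_increments -sumrB (le_trans (ler_norm_sum _ _ _))//.
  apply: (@le_trans _ _ (\sum_(j < k) (delta / k%:R))).
    by apply: ler_sum => j _; have [[]] := WP j (ltn_ord j).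
  by rewrite sumr_const card_ord -[X in X <= _]mulr_natr divfK// gt_eqF.
- apply: (@le_trans _ _ (\sum_(j < k) (delta / k%:R))).
    by apply: ler_sum => j _; have [_ [_ [[]]]] := WP j (ltn_ord j).
  by rewrite sumr_const card_ord -[X in X <= _]mulr_natr divfK// gt_eqF.
- move=> x; rewrite /Lam (flD x 1) rmorphD/= mulrDl mul1r.
  by rewrite opprD addrACA subrr addr0 addrAC.
- move=> x y xy; rewrite /Lam.
  have fxy : fl x <= fl y by apply: le_floor; rewrite lerD2r.
  have /andP[? x1] := L0b (x - (fl x)%:~R); have /andP[y0 ?] := L0b (y - (fl y)%:~R).
  have D0 : 0 <= D by lra.
  move: fxy; rewrite le_eqVlt => /orP[/eqP <-|].
    by rewrite lerD2l L0S// lerD2r.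
  rewrite -lezD1 -(ler_int R) intrD1 => fxy.
  by have : ((fl x)%:~R + 1) * D <= (fl y)%:~R * D by [exact: ler_wpM2r]; lra.
- move=> j z u v jk zu uv vz uvd.
  have b0j : beta 0%N <= beta j by apply: b_le => //; exact: ltnW.
  have bj1 : beta j.+1 <= beta 0%N + 1 by rewrite -bk b_le.
  have flu : fl u = z by apply: floor_unit; lra.
  have flv : fl v = z by apply: floor_unit; lra.
  pose u' := u - z%:~R; pose v' := v - z%:~R.
  have uE : u = u' + z%:~R by rewrite subrK.
  have fu : f u = f u' by rewrite uE circle_function_int.
  have fv : f v = f v' by rewrite -(circle_function_int v' z) subrK.
  have sgu : sg u = sgj j u'.
    rewrite /sg (bigD1 (Ordinal jk))//= big1 => [|j'].
      by rewrite addr0 uE; have [_ [[->]]] := WP j jk.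
    rewrite -(inj_eq val_inj)/= neq_ltn => jj'.
    have [_ [[per zero] _]] := WP j' (ltn_ord j'); rewrite uE per.
    have bj'0 := b_le 0%N j' isT (ltnW (ltn_ord j')).
    case/orP: jj' => lt.
      by apply: zero; rewrite /u'; [have := b_le _ _ lt (ltnW jk)|]; lra.
    rewrite -(per u' 1); apply: zero; rewrite /u'.
      by have := b_le _ _ (ltn_ord j') (leqnn k); rewrite bk; lra.
    by have := b_le _ _ lt (ltnW (ltn_ord j')); lra.
  have LE : Lam v - Lam u = L0 v' - L0 u' by rewrite /Lam flu flv -/u' -/v'; ring.
  have vu : v - u = v' - u' by rewrite /v' /u'; ring.
  rewrite LE fu fv sgu vu.
  have [_ [_ [_ est]]] := WP j jk.
  apply: (@le_trans _ _ (Lj j v' - Lj j u')).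
    apply: est; rewrite /u' /v'; [lra|lra|lra|].
    by have := dP j jk; lra.
  rewrite /L0 -sumrB (bigD1 (Ordinal jk))//= lerDl sumr_ge0// => i _.
  by rewrite subr_ge0 LjS// lerD2r.
Qed.

End circle_approximation.

(** * Cutting the circle into arcs of almost linear Birkhoff sums *)

Section level_covering.
Variable R : realType.
Implicit Types (x y r : R) (s : seq R).

Definition covered (E : set R) (r : R) (s : seq R) :=
  forall x, E x -> exists2 y, y \in s & `|x - y| <= r.

(** A return is a pair (j, x) with Q j x.  In each level set the returns use at most
    N + 1 consecutive indices j, and for each of these the points lie within r of
    any one of them, which serves as a center. *)
Lemma cover_levels (E : set R) (Theta : R -> int) (Q : nat -> R -> Prop)
    (h0 : int) (L N : nat) r :
  (forall x, E x -> h0 <= Theta x <= h0 + L%:Z) ->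
  (forall x, E x -> exists j, Q j x) ->
  (forall j x y, Theta x = Theta y -> Q j x -> Q j y -> `|x - y| <= r) ->
  (forall i j x y, Theta x = Theta y -> Q i x -> Q j y -> (j <= i + N)%N) ->
  exists s, covered E r s /\ (size s <= L.+1 * N.+1)%N.
Proof.
move=> EL EQ near few.
have level (h : int) : exists s,
    covered [set x | E x /\ Theta x = h] r s /\ (size s <= N.+1)%N.
  pose P j := `[< exists x, Theta x = h /\ Q j x >].
  have [exP|none] := pselect (exists j, P j); last first.
    exists [::]; split=> // x [/EQ[j Qj] xh]; exfalso; apply: none.
    by exists j; apply/asboolP; exists x.
  have [j0 /asboolP[x0 [x0h Qx0]] j0min] := ex_minnP exP.
  pose c j := xget 0 [set y | Theta y = h /\ Q j y].
  exists [seq c j | j <- iota j0 N.+1]; split; last by rewrite size_map size_iota.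
  move=> x [/EQ[j Qj] xh]; exists (c j).
    apply: map_f; rewrite mem_iota addnS ltnS.
    rewrite (few _ _ x0 x) ?x0h// andbT; apply: j0min.
    by apply/asboolP; exists x.
  have [ch Qc] : [set y | Theta y = h /\ Q j y] (c j).
    by apply: xgetPex; exists x.
  by apply: near Qj Qc; rewrite xh.
have [W WP] := choice level.
exists (flatten [seq W (h0 + i%:Z) | i <- iota 0 L.+1]); split.
  move=> x Ex; have /andP[hx xh] := EL x Ex.
  have [WC _] := WP (Theta x); have [y yW xy] := WC x (conj Ex erefl).
  exists y => //; apply/flattenP; exists (W (Theta x)) => //.
  apply/mapP; exists `|Theta x - h0|%N; first by rewrite mem_iota; lia.
  by rewrite gez0_abs ?subr_ge0//; congr W; lia.
elim: L.+1 0%N => [|n IH] m //=; rewrite size_cat mulSn leq_add//.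
by have [] := WP (h0 + m%:Z).
Qed.

End level_covering.

Section return_levels.
Variables (R : realType) (alpha : R) (f : R -> R) (k : nat) (beta : nat -> R).
Hypotheses (f_circle : circle_function f) (f_pw_ac : pw_abs_continuous f k beta).
Implicit Types (d x y u v D : R).

(** The Birkhoff sum f^(j) along the lifted orbit, which is not reduced modulo 1, so
    that two close points stay close along their orbits. *)
Definition line_sum (j : nat) x := \sum_(i < j) f (x + i%:R * alpha).

Variables (Lam : R -> R) (eps : R) (J : nat).
Hypotheses (eps0 : 0 < eps) (Lam_le : forall x y, x <= y -> Lam x <= Lam y).

Definition orbit_Lam x := \sum_(i < J) Lam (x + i%:R * alpha).

(** Each term jumps where a cut is wanted: at the discontinuities of the f^(j) with
    j <= J, at the multiples of 1 / J, and whenever the accumulated error has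
    grown by eps.  Using both the integer part and its upper counterpart isolates
    the discontinuities, so that a level set with two points contains none. *)
Definition level x : int :=
  \sum_(i < J) \sum_(m < k) (Num.floor (x + i%:R * alpha - beta m) +
                             Num.ceil (x + i%:R * alpha - beta m))
  + (Num.floor (J%:R * x) + Num.floor (orbit_Lam x / eps)).

Lemma orbit_Lam_le x y : x <= y -> orbit_Lam x <= orbit_Lam y.
Proof. by move=> xy; apply: ler_sum => i _; apply: Lam_le; rewrite lerD2r. Qed.

Lemma level_le x y : x <= y -> level x <= level y.
Proof.
move=> xy; rewrite /level !lerD//.
- apply: ler_sum => i _; apply: ler_sum => m _.
  by rewrite lerD ?le_floor ?le_ceil// lerD2r lerD2r.
- by apply: le_floor; rewrite ler_wpM2l.
- by apply: le_floor; rewrite ler_pM2r ?invr_gt0// orbit_Lam_le.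
Qed.

(** Over a period, each of the k J discontinuities counts twice, the multiples of
    1 / J count J times, and the error grows by J D <= J eps. *)
Lemma level_range D x : D <= eps -> (forall x, Lam (x + 1) = Lam x + D) ->
  0 <= x < 1 ->
  level 0 <= level x <= level 0 + (2 * k * J + 2 * J)%:Z.
Proof.
move=> D_eps Lam_per /andP[x0 x1]; rewrite level_le//= (le_trans (level_le (ltW x1)))//.
have b (i : 'I_J) (m : 'I_k) : Num.floor (1 + i%:R * alpha - beta m) +
    Num.ceil (1 + i%:R * alpha - beta m) = (Num.floor (0 + i%:R * alpha - beta m) +
    Num.ceil (0 + i%:R * alpha - beta m)) + 2.
  have -> : 1 + i%:R * alpha - beta m = (0 + i%:R * alpha - beta m) + 1%:~R by ring.
  by rewrite floor_addint ceilDrz ?intr_int// intrKceil addrACA.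
have O : Num.floor (orbit_Lam 1 / eps) <= Num.floor (orbit_Lam 0 / eps) + J%:Z.
  rewrite -floor_addint; apply: le_floor.
  rewrite ler_pdivrMr// mulrDl divfK ?gt_eqF//.
  have -> : orbit_Lam 1 = orbit_Lam 0 + J%:R * D.
    have -> : J%:R * D = \sum_(i < J) D by rewrite sumr_const card_ord mulr_natl.
    rewrite /orbit_Lam -big_split/=.
    by apply: eq_bigr => i _; rewrite add0r [1 + _]addrC Lam_per.
  by rewrite lerD2l ler_wpM2l.
have fJ : Num.floor (J%:R : R) = J%:Z by exact: (intrKfloor J%:Z).
have sumE : \sum_(i < J) \sum_(m < k) (Num.floor (1 + i%:R * alpha - beta m) +
    Num.ceil (1 + i%:R * alpha - beta m)) =
  \sum_(i < J) \sum_(m < k) (Num.floor (0 + i%:R * alpha - beta m) +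
    Num.ceil (0 + i%:R * alpha - beta m)) + (2 * k * J)%:Z.
  under eq_bigr do (under eq_bigr do rewrite b; rewrite big_split/=).
  rewrite big_split/=; congr (_ + _); rewrite !sumr_const !card_ord.
  rewrite -mulrnA -mulr_natr natz; lia.
rewrite /level mulr1 mulr0 floor0 fJ sumE; move: O.
move: (\sum_(i < J) _) (Num.floor (orbit_Lam 1 / _)) (Num.floor (orbit_Lam 0 / _)).
by move=> X O1 O0; lia.
Qed.

(** All the terms of [level] are nondecreasing, so equality of the sums forces
    equality of each term. *)
Lemma sum_eq_terms (n : nat) (a b : 'I_n -> int) : (forall i, a i <= b i) ->
  \sum_(i < n) a i = \sum_(i < n) b i -> forall i, a i = b i.
Proof.
move=> ab /eqP; rewrite eq_sym -subr_eq0 -sumrB => /eqP s0 i.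
apply/esym/eqP; rewrite -subr_eq0; apply/eqP.
by apply: (psumr_eq0P _ s0) => // j _; rewrite subr_ge0.
Qed.

Lemma level_eq x y : x <= y -> level x = level y ->
  [/\ forall (i : 'I_J) (m : 'I_k),
        Num.floor (x + i%:R * alpha - beta m) = Num.floor (y + i%:R * alpha - beta m) /\
        Num.ceil (x + i%:R * alpha - beta m) = Num.ceil (y + i%:R * alpha - beta m),
      Num.floor (J%:R * x) = Num.floor (J%:R * y) &
      Num.floor (orbit_Lam x / eps) = Num.floor (orbit_Lam y / eps)].
Proof.
move=> xy; rewrite /level.
pose F z (i : 'I_J) (m : 'I_k) := Num.floor (z + i%:R * alpha - beta m).
pose C z (i : 'I_J) (m : 'I_k) := Num.ceil (z + i%:R * alpha - beta m).
have Fxy i m : F x i m <= F y i m by apply: le_floor; rewrite lerD2r lerD2r.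
have Cxy i m : C x i m <= C y i m by apply: le_ceil; rewrite lerD2r lerD2r.
have FCxy i : \sum_(m < k) (F x i m + C x i m) <= \sum_(m < k) (F y i m + C y i m).
  by apply: ler_sum => m _; rewrite lerD.
have sxy : \sum_(i < J) \sum_(m < k) (F x i m + C x i m)
    <= \sum_(i < J) \sum_(m < k) (F y i m + C y i m) by exact: ler_sum.
have Jxy : Num.floor (J%:R * x) <= Num.floor (J%:R * y).
  by apply: le_floor; rewrite ler_wpM2l.
have Oxy : Num.floor (orbit_Lam x / eps) <= Num.floor (orbit_Lam y / eps).
  by apply: le_floor; rewrite ler_pM2r ?invr_gt0// orbit_Lam_le.
rewrite -!/(F _ _ _) -!/(C _ _ _) => e.
have [e1 e2 e3] : [/\ \sum_(i < J) \sum_(m < k) (F x i m + C x i m)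
     = \sum_(i < J) \sum_(m < k) (F y i m + C y i m),
    Num.floor (J%:R * x) = Num.floor (J%:R * y) &
    Num.floor (orbit_Lam x / eps) = Num.floor (orbit_Lam y / eps)].
  move: sxy Jxy Oxy e; rewrite /F /C.
  move: (\sum_(i < J) _) (\sum_(i < J) _) => A A'.
  move: (Num.floor _) (Num.floor _) (Num.floor _) (Num.floor _) => B B' E E' *.
  by split; lia.
split=> // i m.
have em := sum_eq_terms (fun m => lerD (Fxy i m) (Cxy i m)) (sum_eq_terms FCxy e1 i) m.
have := Fxy i m; have := Cxy i m; move: em; rewrite /F /C.
by move: (Num.floor _) (Num.floor _) (Num.ceil _) (Num.ceil _) => *; split; lia.
Qed.

Let k0 : (0 < k)%N. Proof. by case: f_pw_ac. Qed.
Let bk : beta k = beta 0%N + 1. Proof. by case: f_pw_ac. Qed.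

Lemma level_same_arc x y (i : nat) : x < y -> level x = level y -> (i < J)%N ->
  exists (j : nat) (z : int), [/\ (j < k)%N, z%:~R + beta j < x + i%:R * alpha &
    y + i%:R * alpha < z%:~R + beta j.+1].
Proof.
move=> xy /(level_eq (ltW xy))[FC _ _] iJ.
have {FC} FC m : (m < k)%N ->
  Num.floor (x + i%:R * alpha - beta m) = Num.floor (y + i%:R * alpha - beta m) /\
  Num.ceil (x + i%:R * alpha - beta m) = Num.ceil (y + i%:R * alpha - beta m).
  by move=> mk; have := FC (Ordinal iJ) (Ordinal mk).
set u := x + i%:R * alpha in FC *; set v := y + i%:R * alpha in FC *.
have uv : u < v by rewrite ltrD2r.
set z := Num.floor (u - beta 0%N); have [z1 z2] := floor_bounds (u - beta 0%N).
rewrite -/z in z1 z2.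
have [||j jk /andP[ju uj]] := @locate_node R beta k (u - z%:~R); [lra|rewrite bk; lra|].
exists j, z; split=> //.
  have : z%:~R + beta j != u.
    apply/eqP => zu; have [_ cE] := FC j jk.
    have cu : Num.ceil (u - beta j) = z by rewrite -zu addrK intrKceil.
    have : v - beta j <= z%:~R by rewrite -cu cE ceil_ge.
    by lra.
  by move=> h; rewrite lt_neqAle h; lra.
have [j1k|] := ltnP j.+1 k; last first.
  move=> kj; have -> : j.+1 = k by apply/eqP; rewrite eqn_leq jk kj.
  rewrite bk; have [fE _] := FC 0%N k0.
  by have [_] := floor_bounds (v - beta 0%N); rewrite -fE -/z; lra.
have [fE _] := FC j.+1 j1k; rewrite ltNge; apply/negP => zv.
have : z <= Num.floor (u - beta j.+1) by rewrite fE floor_ge_int; lra.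
by rewrite floor_ge_int; lra.
Qed.

(** The errors of the successive terms add up to an increment of [orbit_Lam], which
    stays below eps within a level set, for all j <= J at the same time. *)
Lemma level_increment (sg : R -> R) d x y (j : nat) : 1 <= J%:R * d ->
  (forall (j : nat) (z : int) u v, (j < k)%N ->
    z%:~R + beta j < u -> u <= v -> v < z%:~R + beta j.+1 -> v - u < d ->
    `|f v - f u - sg u * (v - u)| <= Lam v - Lam u) ->
  x <= y -> level x = level y -> (j <= J)%N ->
  `|line_sum j y - line_sum j x - (\sum_(i < j) sg (x + i%:R * alpha)) * (y - x)| <= eps
  /\ J%:R * (y - x) <= 1.
Proof.
move=> Jd approx; rewrite le_eqVlt => /orP[/eqP -> _ _|xy lxy jJ].
  by rewrite !subrr !mulr0 subrr normr0 ler01 ltW.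
have [_ Jxy Oxy] := level_eq (ltW xy) lxy.
have Jyx : J%:R * (y - x) < 1.
  have [_ h1] := floor_bounds (J%:R * y); have [h2 _] := floor_bounds (J%:R * x).
  by rewrite mulrBr; rewrite Jxy in h2; lra.
split; last exact: ltW.
have J0 : 0 < J%:R :> R.
  rewrite ltr0n lt0n; apply/eqP => J0; move: Jd; rewrite J0; lra.
have yxd : y - x < d by rewrite -(ltr_pM2l J0); exact: lt_le_trans Jyx Jd.
apply: (@le_trans _ _ (orbit_Lam y - orbit_Lam x)); last first.
  have [_ lo1] := floor_bounds (orbit_Lam y / eps).
  have [lo2 _] := floor_bounds (orbit_Lam x / eps).
  rewrite Oxy in lo2.
  have : (orbit_Lam y - orbit_Lam x) / eps <= 1 by rewrite mulrBl; lra.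
  by rewrite ler_pdivrMr// mul1r.
apply: (@le_trans _ _ (\sum_(i < j) (Lam (y + i%:R * alpha) - Lam (x + i%:R * alpha)))).
  rewrite /line_sum -sumrB mulr_suml -sumrB (le_trans (ler_norm_sum _ _ _))//.
  apply: ler_sum => i _.
  have [m [z [mk zx yz]]] := level_same_arc xy lxy (leq_trans (ltn_ord i) jJ).
  have -> : y - x = (y + i%:R * alpha) - (x + i%:R * alpha) by ring.
  apply: approx mk zx _ yz _; first by rewrite lerD2r ltW.
  by rewrite opprD addrACA subrr addr0.
rewrite /orbit_Lam -sumrB
  -!(big_mkord predT (fun i => Lam (y + i%:R * alpha) - Lam (x + i%:R * alpha))).
rewrite [leRHS](big_cat_nat (n := j))//= lerDl sumr_ge0// => i _.
by rewrite subr_ge0 Lam_le// lerD2r ltW.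
Qed.

End return_levels.

(** * The return set has small measure *)

Section sparse_returns.
Variables (R : realType) (alpha : R) (f : R -> R) (k : nat) (beta : nat -> R).
Hypotheses (f_circle : circle_function f) (f_pw_ac : pw_abs_continuous f k beta).
Implicit Types (x y u v t eps : R).

(** On each arc, f differs from its one-sided limit by at most its variation; the
    values at the break points are finitely many. *)
Lemma pw_ac_bounded : exists2 F : R, 0 < F & forall x, f x <= F.
Proof.
have [k0 bk bS ac] := f_pw_ac.
pose fh j := arc_extension (beta j) (beta j.+1) f.
pose V j := variation_function (beta j) (fh j) (beta j.+1).
have V0 j : (j < k)%N -> 0 <= V j.
  by move=> jk; rewrite fine_ge0// total_variation_ge0// ltW// bS.
pose F := \sum_(j < k) (`|f (beta j)| + (`|fh j (beta j)| + V j)) + 1.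
have term0 (j : 'I_k) : 0 <= `|f (beta j)| + (`|fh j (beta j)| + V j).
  by rewrite !addr_ge0 ?normr_ge0 ?V0.
have FP j : (j < k)%N -> `|f (beta j)| + (`|fh j (beta j)| + V j) <= F.
  move=> jk; rewrite /F (bigD1 (Ordinal jk))//= -addrA lerDl addr_ge0// sumr_ge0// => i _.
exists F => [|x]; first by rewrite ltr_wpDl// sumr_ge0.
set z := Num.floor (x - beta 0%N); have [z1 z2] := floor_bounds (x - beta 0%N).
rewrite -/z in z1 z2; pose y := x - z%:~R.
have -> : f x = f y by rewrite -(circle_function_int f_circle y z) subrK.
have [||j jk /andP[jy yj]] := @locate_node R beta k y; [by rewrite /y; lra|by rewrite bk /y; lra|].
apply: le_trans (FP j jk).
have [->|yNj] := eqVneq y (beta j).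
  by rewrite (le_trans (ler_norm _))// lerDl addr_ge0// V0.
have {}jy : beta j < y by rewrite lt_neqAle eq_sym yNj.
have -> : f y = fh j y by rewrite /fh arc_extension_in// jy.
have bv := ac_bounded_variation (bS j jk) (ac j jk).
have inc := variation_function_increment bv (lexx _) (ltW jy) (ltW yj).
have inc' := variation_function_increment bv (ltW jy) (ltW yj) (lexx _).
rewrite {2}/variation_function total_variationxx/= subr0 in inc.
have := ler_norm (fh j y - fh j (beta j)); have := ler_norm (fh j (beta j)).
have := normr_ge0 (f (beta j)); have := normr_ge0 (fh j (beta j.+1) - fh j y).
rewrite /V; rewrite -/(fh j) in inc inc'; lra.
Qed.

Lemma sum_ge_const (c : R) (F : nat -> R) i j : (forall n, c <= F n) -> (i <= j)%N ->
  \sum_(n < i) F n + (j - i)%:R * c <= \sum_(n < j) F n.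
Proof.
move=> cF ij; rewrite -!(big_mkord predT F) [leRHS](big_cat_nat (n := i))//= lerD2l.
have -> : (j - i)%:R * c = \sum_(i <= n < j) c by rewrite sumr_const_nat mulr_natl.
by apply: ler_sum_nat.
Qed.

Lemma dist_le2 (a b t e : R) : `|a - t| < e -> `|b - t| < e -> `|a - b| <= 2 * e.
Proof. by rewrite !ltr_norml ler_norml => /andP[? ?] /andP[? ?]; apply/andP; split; lra. Qed.

Lemma almost_linear_bounds (A D S h e : R) (n : nat) : 0 <= h ->
  `|A - n%:R * S| <= n%:R * (`|S| / 2) -> `|D - A * h| <= e ->
  n%:R * (`|S| / 2) * h <= `|D| + e /\ `|D| <= n%:R * (3 / 2 * `|S|) * h + e.
Proof.
move=> h0 AS DA.
have nS : `|n%:R * S| = n%:R * `|S| by rewrite normrM ger0_norm.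
have Ah : `|A * h| = `|A| * h by rewrite normrM (ger0_norm h0).
have A1 : n%:R * (`|S| / 2) <= `|A|.
  by have := ler_distD A 0 (n%:R * S); rewrite !sub0r !normrN nS; lra.
have A2 : `|A| <= n%:R * (3 / 2 * `|S|).
  by have := ler_distD (n%:R * S) 0 A; rewrite !sub0r !normrN nS distrC; lra.
split.
  apply: (le_trans (ler_wpM2r h0 A1)); rewrite -Ah.
  by have := ler_distD D 0 (A * h); rewrite !sub0r !normrN; lra.
have := ler_wpM2r h0 A2; rewrite -Ah.
by have := ler_distD (A * h) 0 D; rewrite !sub0r !normrN distrC; lra.
Qed.

(** Here w is the distance of two returns with the same index j in one level set:
    the slope is at least j kap / 2, and j is at least of the order of J. *)
Lemma level_width (c F kap w e t : R) (j J : nat) :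
  0 < c -> 0 < F -> 0 < kap -> 0 <= w -> (0 < J)%N -> c * J%:R <= 4 * t ->
  t < 2 * F * j%:R -> j%:R * (kap / 2) * w <= 3 * e ->
  w <= 48 * F * e / (c * kap * J%:R).
Proof.
move=> c0 F0 kap0 w0 J0 Jt tj jw; have JR : 0 < J%:R :> R by rewrite ltr0n.
rewrite ler_pdivlMr ?mulr_gt0//.
have h1 : c * J%:R <= 8 * F * j%:R by lra.
have h2 := ler_wpM2r (mulr_ge0 (ltW kap0) w0) h1.
have h3 := ler_wpM2l (mulr_ge0 (ler0n R 16) (ltW F0)) jw.
rewrite [leLHS](_ : _ = c * J%:R * (kap * w)); last by ring.
apply: (le_trans h2); rewrite [leLHS](_ : _ = 16 * F * (j%:R * (kap / 2) * w)); last by field.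
by apply: (le_trans h3); lra.
Qed.

Lemma iteration_bound (c t : R) : 0 < c -> c <= t ->
  exists J : nat, [/\ (0 < J)%N, 2 * t < c * J%:R & c * J%:R <= 4 * t].
Proof.
move=> c0 ct; exists (Num.truncn (2 * t / c)).+1; split=> //.
  by rewrite [ltRHS]mulrC -ltr_pdivrMr//; exact: truncnS_gt.
have : (Num.truncn (2 * t / c))%:R <= 2 * t / c.
  by rewrite truncn_le divr_ge0 ?(ltW c0)//; lra.
rewrite -natr1 ler_pdivlMr// => h; lra.
Qed.

Definition return_set t eps : set R :=
  [set x | 0 <= x < 1 /\ exists j, `|line_sum alpha f j x - t| < eps].

(** A level set contributes intervals of radius r = O(eps / J) for at most N0 + 1
    indices j, and there are O(J) level sets. *)
Theorem sparse_returns : irrational alpha ->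
  (exists2 c : R, 0 < c & forall x, c <= f x) -> sum_of_jumps f k beta <> 0 ->
  exists2 C : R, 0 < C & forall eps, 0 < eps -> eps <= 1 ->
    exists t0 : R, forall t, t0 <= t -> exists (r : R) (s : seq R),
      [/\ 0 <= r, covered (return_set t eps) r s & (size s)%:R * (2 * r) <= C * eps].
Proof.
move=> irr [c0 c00 fc0] /eqP S0; set S := sum_of_jumps f k beta in S0.
have [F F0 fF] := pw_ac_bounded.
pose kap := `|S|; have kap0 : 0 < kap by rewrite normr_gt0.
have [N0 N0P] : exists N0 : nat, (3 + 2 * kap) / c0 < N0%:R.
  by exists (Num.truncn ((3 + 2 * kap) / c0)).+1; exact: truncnS_gt.
exists ((2 * k + 3)%:R * N0.+1%:R * (96 * F / (c0 * kap))).
  by rewrite !mulr_gt0 ?ltr0n ?addn_gt0 ?orbT// invr_gt0 mulr_gt0.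
move=> eps eps0 eps1.
have kap4 : 0 < kap / 4 by rewrite divr_gt0.
have [delta [delta0 deltae deltak]] := gt0_lower_bound eps0 kap4.
have [sg [Lam [c [D [d [[d0 avg cS] [[Dd Lper Lle] approx]]]]]]] :=
  circle_approximation f_circle f_pw_ac irr delta0.
have [n0 n0P] := avg _ kap4.
have slope (n : nat) x : (n0 <= n)%N ->
    `|\sum_(i < n) sg (x + i%:R * alpha) - n%:R * S| <= n%:R * (kap / 2).
  move=> nn; have := n0P n x nn; set A := \sum_(i < n) _ => Ac.
  have -> : A - n%:R * S = (A - n%:R * c) + n%:R * (c - S) by ring.
  rewrite (le_trans (ler_normD _ _))// normrM (ger0_norm (ler0n _ _)).
  have : n%:R * `|c - S| <= n%:R * (kap / 4).
    by rewrite ler_wpM2l// (le_trans cS)// (le_trans deltak).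
  lra.
(* t >= 2 eps, and t large enough for c0 J <= 4 t, 1 / J <= d and n0 <= j at returns *)
exists (2 + c0 + c0 / d + 2 * F * n0%:R) => t tt.
have q0 : 0 <= c0 / d by rewrite divr_ge0// ltW.
have q1 : 0 <= 2 * F * n0%:R by rewrite !mulr_ge0// ltW.
have t2 : 2 <= t by lra.
have tc0 : c0 <= t by lra.
have tcd : c0 / d <= t by lra.
have tn0 : 2 * F * n0%:R <= t by lra.
have [J [Jn J1 J2]] := iteration_bound c00 tc0.
have J0 : 0 < J%:R :> R by rewrite ltr0n.
have Jd : 1 <= J%:R * d.
  have h : c0 <= t * d by rewrite -ler_pdivrMr.
  have : c0 * 1 <= c0 * (J%:R * d).
    rewrite mulr1 mulrA; apply: (le_trans h); rewrite ler_wpM2r ?ltW//; lra.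
  by rewrite ler_pM2l.
have D_eps : D <= eps by exact: le_trans deltae.
pose Q j x := `|line_sum alpha f j x - t| < eps.
have lf j x : line_sum alpha f j x <= j%:R * F.
  rewrite /line_sum (le_trans (_ : _ <= \sum_(i < j) F))//; first exact: ler_sum.
  by rewrite sumr_const card_ord mulr_natl.
have lc i j x : (i <= j)%N ->
    line_sum alpha f i x + (j - i)%:R * c0 <= line_sum alpha f j x.
  by move=> ij; apply: (sum_ge_const (fun n => fc0 (x + n%:R * alpha))).
have QJ j x : Q j x -> (j <= J)%N.
  rewrite /Q ltr_norml => /andP[_ h]; rewrite -(ler_nat R) -(ler_pM2l c00) ltW//.
  apply: le_lt_trans J1; have := lc 0%N j x isT.
  by rewrite {1}/line_sum big_ord0 add0r subn0 mulrC; lra.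
have Qt j x : Q j x -> t < 2 * F * j%:R.
  by rewrite /Q ltr_norml => /andP[h _]; have := lf j x; lra.
have Qn j x : Q j x -> (n0 <= j)%N.
  move=> /Qt h; rewrite ltnW// -(ltr_nat R) -(@ltr_pM2l _ (2 * F)) ?mulr_gt0//.
  exact: le_lt_trans tn0 h.
pose lev := level alpha k beta Lam eps J.
have inc x y j : lev x = lev y -> (n0 <= j)%N -> (j <= J)%N ->
  [/\ j%:R * (kap / 2) * `|x - y| <= `|line_sum alpha f j x - line_sum alpha f j y| + eps,
      `|line_sum alpha f j x - line_sum alpha f j y| <= j%:R * (3 / 2 * kap) * `|x - y| + eps &
      J%:R * `|x - y| <= 1].
  wlog xy : x y / x <= y => [H|].
    move=> e n1 n2; have [xy|/ltW yx] := leP x y; first exact: H.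
    by have := H y x yx (esym e) n1 n2; rewrite (distrC y x) (distrC (line_sum _ f _ y)).
  move=> e n1 n2.
  have [b1 b2] := level_increment f_pw_ac eps0 Lle Jd approx xy e n2.
  have yx0 : 0 <= y - x by rewrite subr_ge0.
  have [b3 b4] := almost_linear_bounds yx0 (slope j x n1) b1.
  by rewrite (distrC x y) (distrC (line_sum _ f _ x)) (ger0_norm yx0).
pose r := 48 * F * eps / (c0 * kap * J%:R).
have den0 : 0 < c0 * kap * J%:R by rewrite !mulr_gt0.
have r0 : 0 <= r by rewrite divr_ge0 ?(ltW den0)// mulr_ge0 ?(ltW eps0)// mulr_ge0 ?(ltW F0).
have [s [sE sz]] : exists s, covered (return_set t eps) r s /\
    (size s <= (2 * k * J + 2 * J).+1 * N0.+1)%N.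
  apply: (@cover_levels _ _ lev Q (lev 0)).
  - by move=> x [x01 _]; apply: (level_range alpha k beta J eps0 Lle D_eps Lper x01).
  - by move=> x [_ []] j; exists j.
  - move=> j x y e Qx Qy; have [h _ _] := inc x y j e (Qn j x Qx) (QJ j x Qx).
    have jt := Qt j x Qx.
    have h2 := dist_le2 Qx Qy.
    apply: (level_width c00 F0 kap0 (normr_ge0 _) Jn J2 jt).
    by apply: (le_trans h); lra.
  - move=> i j x y e Qx Qy; rewrite leqNgt; apply/negP => ij.
    have ij' : (i <= j)%N by exact: ltnW (leq_ltn_trans (leq_addr _ _) ij).
    have [_ h hJ] := inc x y j e (Qn j y Qy) (QJ j y Qy).
    have hl := lc i j x ij'.
    have : (j - i)%:R * c0 <= 3 + 2 * kap.
      have h2 : j%:R * (3 / 2 * kap) * `|x - y| <= 3 / 2 * kap.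
        have jJ : j%:R <= J%:R :> R by rewrite ler_nat (QJ j y Qy).
        have n0' : 0 <= 3 / 2 * kap by lra.
        have : j%:R * `|x - y| <= 1 by apply: le_trans hJ; rewrite ler_wpM2r.
        move=> /(ler_wpM2l n0'); rewrite mulr1; apply: le_trans.
        by rewrite le_eqVlt; apply/orP; left; apply/eqP; ring.
      have := ler_norm (line_sum alpha f j x - line_sum alpha f j y).
      move: Qx Qy; rewrite /Q !ltr_norml => /andP[? ?] /andP[? ?]; lra.
    by rewrite -ler_pdivlMr// => /le_lt_trans/(_ N0P); rewrite ltr_nat ltnNge leq_subRL// (ltnW ij).
exists r, s; split=> //.
have sz2 : (size s)%:R <= (2 * k + 3)%:R * J%:R * N0.+1%:R :> R.
  have leL : ((2 * k * J + 2 * J).+1 <= (2 * k + 3) * J)%N.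
    by rewrite -addn1 mulnDl -addnA leq_add2l -[3%N]/(2 + 1)%N mulnDl mul1n leq_add2l.
  by rewrite -!natrM ler_nat (leq_trans sz)// leq_mul2r leL orbT.
apply: (le_trans (ler_wpM2r (mulr_ge0 (ler0n R 2) r0) sz2)).
rewrite le_eqVlt; apply/orP; left; apply/eqP; rewrite /r; field.
by rewrite !gt_eqF.
Qed.

End sparse_returns.

(** * Returns of the special flow to a low box *)

Section special_flow_returns.
Variables (R : realType) (alpha : R) (f : R -> R).
Hypothesis f_circle : circle_function f.
Implicit Types (x s t eps : R).

Lemma iter_rotation (a x : R) (n : nat) :
  exists z : int, iter n (rotation a) x = x + n%:R * a + z%:~R.
Proof.
elim: n => [|n [z IH]]; first by exists 0; rewrite mul0r !addr0.
rewrite iterS IH /rotation; set w := Num.floor _; exists (z - w).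
by rewrite rmorphB/= -natr1; ring.
Qed.

(** Seen from its end point, the backward orbit is a forward orbit. *)
Lemma birkhoff_sum_Negz (n : nat) x : birkhoff_sum alpha f (Negz n) x =
  - line_sum alpha f n.+1 (rotation_iter alpha (Negz n) x).
Proof.
rewrite /birkhoff_sum /line_sum; congr (- _); rewrite (reindex_inj rev_ord_inj)/=.
apply: eq_bigr => i _; rewrite -!iterS.
have [z ->] := iter_rotation (- alpha) x (n.+1 - i.+1).+1.
have [w ->] := iter_rotation (- alpha) x n.+1.
rewrite (circle_function_int f_circle); have -> : (n.+1 - i.+1).+1%:R = n.+1%:R - i%:R :> R.
  by rewrite -natrB 1?ltnW// subSS subSn// -ltnS.
rewrite -(circle_function_int f_circle _ w); congr f; ring.
Qed.

Definition low_box eps : set (plane R) := `[0, 1[%classic `*` `[0, eps[%classic.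

(** If t >= eps, going back by t from a height below eps leaves the fibre downwards,
    so the flow applies a negative iterate of the rotation, whose Birkhoff sum is
    the opposite of a forward sum at the arrival point x; that forward sum differs
    from t by the difference of two heights below eps. *)
Lemma low_box_returns eps t : (forall x, 0 < f x) -> eps <= t ->
  low_box eps `&` (special_flow alpha f (- t) @` low_box eps)
    `<=` return_set alpha f t eps `*` `[0, eps[%classic.
Proof.
move=> f0 et [x s] [[/= x01 s0e]] [[x' s'] [/= x'01 s'0e]].
rewrite /special_flow; set n := special_step _ _ _ _ => -[xE sE].
move: x01 s0e s'0e; rewrite !in_itv/= => x01 s0e s'0e; split => //=.
split=> //; case: n xE sE => m xE sE.
  exfalso; have : 0 <= birkhoff_sum alpha f (Posz m) x'.
    by apply: sumr_ge0 => i _; exact: ltW.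
  move: s0e s'0e => /andP[? ?] /andP[? ?]; lra.
exists m.+1; move: sE; rewrite birkhoff_sum_Negz xE => sE.
by move: s0e s'0e => /andP[? ?] /andP[? ?]; rewrite ltr_norml; apply/andP; split; lra.
Qed.

End special_flow_returns.

Section measures.
Variable R : realType.
Local Open Scope ereal_scope.
Local Notation mu := (@lebesgue_measure R).

(** Monotonicity is needed for sets not known to be measurable, namely images under
    the flow; the measure is given by an outer measure on all sets. *)
Lemma le_lebesgue_measure (A B : set R) : A `<=` B -> mu A <= mu B.
Proof.
move=> AB; rewrite /lebesgue_measure/= /lebesgue_stieltjes_measure/= /measure_extension/=.
by apply: le_mu_ext.
Qed.

(** The integral of a nonnegative function is a supremum over the simple functions
    below it, hence monotone without measurability. *)
Lemma le_integral_nonneg d (T : measurableType d) (m : {measure set T -> \bar R})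
    (g h : T -> \bar R) : (forall x, 0 <= g x) -> (forall x, g x <= h x) ->
  \int[m]_x g x <= \int[m]_x h x.
Proof.
move=> g0 gh; rewrite !ge0_integralTE//; last by move=> x; exact: le_trans (gh x).
apply: ereal_sup_le => _ [w /= wg <-]; exists w => // x.
exact: le_trans (wg x) (gh x).
Qed.

Lemma le_product_lebesgue (A B : set (plane R)) : A `<=` B ->
  (mu \x mu) A <= (mu \x mu) B.
Proof.
move=> AB; apply: le_integral_nonneg => x /=; first exact: outer_measure_ge0.
by apply: le_lebesgue_measure; exact: le_xsection.
Qed.

Lemma covered_measure (E : set R) (r : R) (s : seq R) : (0 <= r)%R -> covered E r s ->
  exists U : set R, [/\ measurable U, E `<=` U & mu U <= ((size s)%:R * (2 * r))%:E].
Proof.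
move=> r0; elim: s E => [|y s IH] E Es.
  exists set0; split=> //; first by move=> x /Es[].
  by rewrite measure0 mul0r.
have [|U [mU EU lU]] := IH (E `\` `[(y - r)%R, (y + r)%R]%classic).
  move=> x [/Es[z + xz] xy]; rewrite inE => /orP[/eqP zy|zs]; last by exists z.
  by exfalso; apply: xy; rewrite /= in_itv/= -ler_distlC distrC -zy.
exists (`[(y - r)%R, (y + r)%R]%classic `|` U); split.
- exact: measurableU.
- by move=> x Ex; have [|] := pselect (`[(y - r)%R, (y + r)%R]%classic x); [left|right; apply: EU].
- apply: (le_trans (measureU2 _ _ _)) => //.
  rewrite /= -natr1 mulrDl mul1r addrC EFinD leeD// lebesgue_measure_itv/=.
  case: ifP => _; last by rewrite lee_fin mulr_ge0.
  by rewrite -EFinD lee_fin; lra.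
Qed.

Lemma limn_einf_le (u : nat -> \bar R) (b : \bar R) (N : nat) :
  (forall n, (N <= n)%N -> u n <= b) -> limn_einf u <= b.
Proof.
move=> ub; rewrite limn_einf_lim (cvg_lim _ (@cvg_einfs_sup _ u))//.
apply: ge_ereal_sup => _ [n _ <-]; apply: (@le_trans _ _ (u (maxn n N))).
  by apply: ereal_inf_lbound; exists (maxn n N) => //=; exact: leq_maxl.
by apply: ub; exact: leq_maxr.
Qed.

End measures.

Theorem theorem11 (R : realType) (alpha : R) (f : R -> R)
    (k : nat) (beta : nat -> R)
    (alpha_irrational : irrational alpha)
    (f_circle : circle_function f)
    (f_pos : forall x, 0 < f x)
    (f_away_from_zero : exists2 c : R, 0 < c & forall x, c <= f x)
    (f_pw_ac : pw_abs_continuous f k beta)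
    (f_jumps : sum_of_jumps f k beta <> 0) :
  ~ partially_rigid (special_space f) (special_measure f) (special_flow alpha f).
Proof.
move=> [t [t_cvg [u [/andP[u0 u1] rigid]]]].
have [c c0 fc] := f_away_from_zero.
have [C C0 CP] := sparse_returns f_circle f_pw_ac alpha_irrational f_away_from_zero f_jumps.
(* height of the box: it fits below the graph of f, and C b <= u / 2 *)
pose b := Num.min 1 (Num.min c (u / (2 * C))).
have b0 : 0 < b by rewrite !lt_min ltr01 c0 divr_gt0// mulr_gt0.
have b1 : b <= 1 by rewrite ge_min lexx.
have bc : b <= c by rewrite !ge_min lexx orbT.
have bu : C * b <= u / 2.
  have : b <= u / (2 * C) by rewrite !ge_min lexx !orbT.
  by rewrite ler_pdivlMr ?mulr_gt0//; lra.
have [t0 t0P] := CP b b0 b1.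
have mA : measurable (low_box b) by apply: measurableX; exact: measurable_itv.
have AX : low_box b `<=` special_space f.
  move=> [x s] [/=]; rewrite !in_itv/= => x01 /andP[s0 sb]; split=> //=.
  by rewrite s0 (lt_le_trans sb)// (le_trans bc).
have muA : special_measure f (low_box b) = b%:E.
  rewrite /special_measure setIidl// product_measure1E//= !lebesgue_measure_itv/=.
  by rewrite !lte_fin ltr01 b0 !sube0 mul1e.
have [N NP] : exists N, forall n, (N <= n)%N -> Num.max t0 b <= t n.
  have /cvgryPge/(_ (Num.max t0 b)) [N _ NP] := t_cvg.
  by exists N => n Nn; exact: NP.
have := rigid _ mA AX; rewrite muA => /le_trans => /(_ (u / 2 * b)%:E).
rewrite -EFinM lee_fin ler_pM2r// => h; have : u <= u / 2; last lra.
apply: h; apply: (@limn_einf_le _ _ _ N) => n /NP; rewrite ge_max => /andP[tn bt].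
have [r [s [r0 cov len]]] := t0P _ tn.
have [U [mU EU lU]] := covered_measure r0 cov.
rewrite /special_measure.
apply: (@le_trans _ _ ((lebesgue_measure \x lebesgue_measure)%E (U `*` `[0, b[%classic))).
  apply: le_product_lebesgue => p [+ _] => /(low_box_returns f_circle f_pos bt)[px ps].
  by split => //; exact: EU.
rewrite product_measure1E//= lebesgue_measure_itv/= lte_fin b0 sube0 EFinM.
apply: lee_wpmul2r; first by rewrite lee_fin ltW.
by rewrite (le_trans lU)// lee_fin (le_trans len).
Qed.
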